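(* Let $p$ be an odd prime, let $m\geqslant 3$ be an integer, and let $\mathcal{H}=\langle a,b \mid a^{p^m}=b^p=1,\ b^{-1}ab=a^{p^{m-1}+1}\rangle$. For any positive integer $n$, the additive group of $\Delta^{n+1}(\mathcal{H})$ is the free abelian group with basis $$\{p^n\alpha_0\}\cup\{p^{n-1}\alpha_i \mid 1\leqslant i\leqslant m\}\cup\{p^n\beta_{kl} \mid 1\leqslant k\leqslant m-1,\ 0\leqslant l\leqslant p-1\}\cup\{p^n\beta_{m0}\}.$$
   Context: For a finite group $G$, a $G$-set is a finite set with a $G$-action, and $[X]$ denotes the isomorphism class of a $G$-set $X$. The Burnside ring $\Omega(G)$ is the group completion of the monoid of isomorphism classes of $G$-sets under $[X]+[Y]=[X\sqcup Y]$ (disjoint union), with multiplication induced by cartesian product $[X][Y]=[X\times Y]$ ($G$ acting diagonally). The augmentation map is the ring homomorphism $\phi:\Omega(G)\to\mathbb{Z}$ induced by sending $[X]$ to the number of points of $X$ fixed by all of $G$. The augmentation ideal is $\Delta(G)=\ker\phi$, and $\Delta^n(G)$ is the $n$-th power of the ideal $\Delta(G)$. For $\mathcal{H}$ (a nonabelian group of order $p^{m+1}$): for $0\leqslant i\leqslant m$ let $N_i=\langle a^{p^i}\rangle$; for $1\leqslant k\leqslant m$ and an integer $l\geqslant 0$ let $M_{kl}=\bigcup_{j=0}^{p-1}(ba^{lp^{k-1}})^jN_k$, which is a subgroup of $\mathcal{H}$. Put $\alpha_i=[\mathcal{H}/N_i]$ and $\beta_{kl}=[\mathcal{H}/M_{kl}]$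 in $\Omega(\mathcal{H})$, where $\mathcal{H}/K$ is the set of left cosets of $K$ with $\mathcal{H}$ acting by left multiplication. *)

(* Defs.v *)
From HB Require Import structures.
From mathcomp Require Import all_boot all_order all_algebra.
From mathcomp Require Import all_fingroup generic_quotient ring boolp.

Set Implicit Arguments.
Unset Strict Implicit.
Unset Printing Implicit Defensive.

Import GRing.Theory.
Local Open Scope ring_scope.
Local Open Scope quotient_scope.

(* A finite G-set is a finType with a (right) MathComp action [to] of the whole
   group; the corresponding left action is g . x = to x g^-1. Equivariance,
   disjoint unions, diagonal products and fixed points do not depend on this
   choice of side. *)

Section GSets.

Variable gT : finGroupType.

Definition gset_iso (T1 T2 : finType)
    (to1 : {action gT &-> T1}) (to2 : {action gT &-> T2}) : Prop :=
  exists2 f : T1 -> T2, bijective f & forall x g, f (to1 x g) = to2 (f x) g.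

Lemma gset_iso_refl (T : finType) (to : {action gT &-> T}) : gset_iso to to.
Proof. by exists id => //; exists id. Qed.

Lemma gset_iso_sym (T1 T2 : finType)
    (to1 : {action gT &-> T1}) (to2 : {action gT &-> T2}) :
  gset_iso to1 to2 -> gset_iso to2 to1.
Proof.
case=> f [f' fK f'K] fE; exists f'; first by exists f.
by move=> x g; apply: (can_inj fK); rewrite fE !f'K.
Qed.

Lemma gset_iso_trans (T1 T2 T3 : finType) (to1 : {action gT &-> T1})
    (to2 : {action gT &-> T2}) (to3 : {action gT &-> T3}) :
  gset_iso to1 to2 -> gset_iso to2 to3 -> gset_iso to1 to3.
Proof.
case=> f bf fE [h bh hE]; exists (h \o f); first exact: bij_comp.
by move=> x g /=; rewrite fE hE.
Qed.

Section Transport.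

Variables (T : finType) (to : {action gT &-> T}).

Definition ord_act_fun (i : 'I_#|T|) (g : gT) : 'I_#|T| :=
  enum_rank (to (enum_val i) g).

Lemma ord_act1 : ord_act_fun^~ 1%g =1 id.
Proof. by move=> i; rewrite /ord_act_fun act1 enum_valK. Qed.

Lemma ord_actM : forall x, act_morph ord_act_fun x.
Proof. by move=> i g h; rewrite /ord_act_fun enum_rankK actM. Qed.

Definition ord_act : {action gT &-> 'I_#|T|} := TotalAction ord_act1 ord_actM.

Lemma ord_act_iso : gset_iso ord_act to.
Proof.
exists enum_val; first exact: enum_val_bij.
by move=> i g; rewrite /= /ord_act_fun enum_rankK.
Qed.

End Transport.

Section SumProd.

Variables (T1 T2 : finType).
Variables (to1 : {action gT &-> T1}) (to2 : {action gT &-> T2}).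

Definition sum_act_fun (x : T1 + T2) (g : gT) : T1 + T2 :=
  match x with inl x1 => inl (to1 x1 g) | inr x2 => inr (to2 x2 g) end.

Lemma sum_act1 : sum_act_fun^~ 1%g =1 id.
Proof. by case=> x /=; rewrite act1. Qed.

Lemma sum_actM : forall x, act_morph sum_act_fun x.
Proof. by case=> x g h /=; rewrite actM. Qed.

Definition sum_act : {action gT &-> (T1 + T2)%type} :=
  TotalAction sum_act1 sum_actM.

Definition prod_act_fun (x : T1 * T2) (g : gT) : T1 * T2 :=
  (to1 x.1 g, to2 x.2 g).

Lemma prod_act1 : prod_act_fun^~ 1%g =1 id.
Proof. by case=> x y; rewrite /prod_act_fun /= !act1. Qed.

Lemma prod_actM : forall x, act_morph prod_act_fun x.
Proof. by case=> x y g h; rewrite /prod_act_fun /= !actM. Qed.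

Definition prod_act : {action gT &-> (T1 * T2)%type} :=
  TotalAction prod_act1 prod_actM.

End SumProd.

Section Trivial.

Variable T : finType.

Definition triv_act_fun (x : T) (g : gT) : T := x.

Lemma triv_act1 : triv_act_fun^~ 1%g =1 id. Proof. by []. Qed.

Lemma triv_actM : forall x, act_morph triv_act_fun x. Proof. by []. Qed.

Definition triv_act : {action gT &-> T} := TotalAction triv_act1 triv_actM.

End Trivial.

Section Cosets.

(* G/K with G acting by left multiplication. K is only required to be a subset,
   so that subgroups described as unions can be used directly. *)

Variable K : {set gT}.

Definition coset_space : finType :=
  {X : {set gT} | X \in lcosets K [set: gT]}.

Lemma coset_act_subproof (X : coset_space) (g : gT) :
  (g^-1 *: val X)%g \in lcosets K [set: gT].
Proof.
case: X => _ /= /lcosetsP[x _ ->].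
by apply/lcosetsP; exists (g^-1 * x)%g; rewrite ?inE // lcosetM.
Qed.

Definition coset_act_fun (X : coset_space) (g : gT) : coset_space :=
  exist _ (g^-1 *: val X)%g (coset_act_subproof X g).

Lemma coset_act1 : coset_act_fun^~ 1%g =1 id.
Proof. by move=> X; apply: val_inj; rewrite /= invg1 mul1g. Qed.

Lemma coset_actM : forall x, act_morph coset_act_fun x.
Proof. by move=> X g h; apply: val_inj; rewrite /= invMg lcosetM. Qed.

Definition coset_act : {action gT &-> coset_space} :=
  TotalAction coset_act1 coset_actM.

End Cosets.

Lemma sum_act_iso (T1 T2 U1 U2 : finType)
    (to1 : {action gT &-> T1}) (to2 : {action gT &-> T2})
    (uo1 : {action gT &-> U1}) (uo2 : {action gT &-> U2}) :
  gset_iso to1 uo1 -> gset_iso to2 uo2 ->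
  gset_iso (sum_act to1 to2) (sum_act uo1 uo2).
Proof.
case=> f [f' fK f'K] fE [h [h' hK h'K] hE].
exists (fun x => match x with inl a => inl (f a) | inr b => inr (h b) end).
  exists (fun x => match x with inl a => inl (f' a) | inr b => inr (h' b) end).
    by case=> x; rewrite ?fK ?hK.
  by case=> x; rewrite ?f'K ?h'K.
by case=> x g /=; rewrite ?fE ?hE.
Qed.

Lemma prod_act_iso (T1 T2 U1 U2 : finType)
    (to1 : {action gT &-> T1}) (to2 : {action gT &-> T2})
    (uo1 : {action gT &-> U1}) (uo2 : {action gT &-> U2}) :
  gset_iso to1 uo1 -> gset_iso to2 uo2 ->
  gset_iso (prod_act to1 to2) (prod_act uo1 uo2).
Proof.
case=> f [f' fK f'K] fE [h [h' hK h'K] hE].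
exists (fun x => (f x.1, h x.2)).
  by exists (fun x => (f' x.1, h' x.2)); case=> x y /=; rewrite ?fK ?hK ?f'K ?h'K.
by move=> x g /=; rewrite /prod_act_fun /= fE hE.
Qed.

(* Every finite G-set is isomorphic to one carried by some 'I_n, so isomorphism
   classes are taken on this small type of representatives. *)
Record ord_gset := OrdGSet {
  ord_gset_card : nat;
  ord_gset_act : {action gT &-> 'I_ord_gset_card}
}.

HB.instance Definition _ := gen_eqMixin ord_gset.
HB.instance Definition _ := gen_choiceMixin ord_gset.

Definition ord_gset_iso (X Y : ord_gset) : bool :=
  `[< gset_iso (ord_gset_act X) (ord_gset_act Y) >].

Lemma ord_gset_iso_refl : reflexive ord_gset_iso.
Proof. by move=> X; apply/asboolP/gset_iso_refl. Qed.

Lemma ord_gset_iso_sym : symmetric ord_gset_iso.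
Proof. by move=> X Y; apply/asboolP/asboolP => /gset_iso_sym. Qed.

Lemma ord_gset_iso_trans : transitive ord_gset_iso.
Proof.
move=> Y X Z /asboolP XY /asboolP YZ.
exact/asboolP/(gset_iso_trans XY YZ).
Qed.

Canonical ord_gset_iso_equiv :=
  EquivRel ord_gset_iso ord_gset_iso_refl ord_gset_iso_sym ord_gset_iso_trans.

Definition gset_class := {eq_quot ord_gset_iso}.

HB.instance Definition _ := Choice.on gset_class.

Definition iso_class (T : finType) (to : {action gT &-> T}) : gset_class :=
  \pi_gset_class (OrdGSet (ord_act to)).

Lemma iso_classP (T1 T2 : finType)
    (to1 : {action gT &-> T1}) (to2 : {action gT &-> T2}) :
  iso_class to1 = iso_class to2 <-> gset_iso to1 to2.
Proof.
split=> [/eqmodP/asboolP /= iso12 | iso12]; last first.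
  apply/eqmodP/asboolP => /=; apply: gset_iso_trans (ord_act_iso to1) _.
  exact/(gset_iso_trans iso12)/gset_iso_sym/ord_act_iso.
apply: gset_iso_trans (gset_iso_sym (ord_act_iso to1)) _.
exact/(gset_iso_trans iso12)/ord_act_iso.
Qed.

Definition class_act (x : gset_class) := ord_gset_act (repr x).

Lemma class_actK (x : gset_class) : iso_class (class_act x) = x.
Proof.
rewrite -[RHS]reprK; apply/eqmodP/asboolP => /=; exact: ord_act_iso.
Qed.

Lemma class_act_iso (T : finType) (to : {action gT &-> T}) :
  gset_iso (class_act (iso_class to)) to.
Proof. by apply/iso_classP; rewrite class_actK. Qed.

Lemma iso_class_ind (P : gset_class -> Prop) :
  (forall (T : finType) (to : {action gT &-> T}), P (iso_class to)) ->
  forall x, P x.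
Proof. by move=> Pc x; rewrite -(class_actK x). Qed.

Definition class_add (x y : gset_class) : gset_class :=
  iso_class (sum_act (class_act x) (class_act y)).

Definition class_mul (x y : gset_class) : gset_class :=
  iso_class (prod_act (class_act x) (class_act y)).

Definition class_zero : gset_class := iso_class (triv_act void).

Definition class_one : gset_class := iso_class (triv_act unit).

Lemma class_addE (T1 T2 : finType)
    (to1 : {action gT &-> T1}) (to2 : {action gT &-> T2}) :
  class_add (iso_class to1) (iso_class to2) = iso_class (sum_act to1 to2).
Proof. by apply/iso_classP/sum_act_iso; apply: class_act_iso. Qed.

Lemma class_mulE (T1 T2 : finType)
    (to1 : {action gT &-> T1}) (to2 : {action gT &-> T2}) :
  class_mul (iso_class to1) (iso_class to2) = iso_class (prod_act to1 to2).
Proof. by apply/iso_classP/prod_act_iso; apply: class_act_iso. Qed.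

Lemma class_addA : associative class_add.
Proof.
elim/iso_class_ind=> T1 to1; elim/iso_class_ind=> T2 to2.
elim/iso_class_ind=> T3 to3; rewrite !class_addE; apply/iso_classP.
exists (fun x => match x with inl a => inl (inl a) | inr (inl b) => inl (inr b)
                 | inr (inr c) => inr c end).
  exists (fun x => match x with inl (inl a) => inl a
            | inl (inr b) => inr (inl b) | inr c => inr (inr c) end).
    by case=> [|[]].
  by case=> [[]|].
by case=> [|[]].
Qed.

Lemma class_addC : commutative class_add.
Proof.
elim/iso_class_ind=> T1 to1; elim/iso_class_ind=> T2 to2.
rewrite !class_addE; apply/iso_classP.
exists (fun x => match x with inl a => inr a | inr b => inl b end).
  by exists (fun x => match x with inl a => inr a | inr b => inl b end); case.
by case.
Qed.

Lemma class_add0 : left_id class_zero class_add.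
Proof.
elim/iso_class_ind=> T to; rewrite class_addE; apply/iso_classP.
exists (fun x => match x with inl a => of_void T a | inr b => b end).
  by exists inr => // -[].
by case.
Qed.

Lemma class_mulA : associative class_mul.
Proof.
elim/iso_class_ind=> T1 to1; elim/iso_class_ind=> T2 to2.
elim/iso_class_ind=> T3 to3; rewrite !class_mulE; apply/iso_classP.
exists (fun x => (x.1, x.2.1, x.2.2)) => //.
by exists (fun x => (x.1.1, (x.1.2, x.2))) => [[? []]|[[]]].
Qed.

Lemma class_mulC : commutative class_mul.
Proof.
elim/iso_class_ind=> T1 to1; elim/iso_class_ind=> T2 to2.
rewrite !class_mulE; apply/iso_classP.
by exists (fun x => (x.2, x.1)) => //; exists (fun x => (x.2, x.1)); case.
Qed.

Lemma class_mul1 : left_id class_one class_mul.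
Proof.
elim/iso_class_ind=> T to; rewrite class_mulE; apply/iso_classP.
by exists snd => //; exists (pair tt) => // -[[]].
Qed.

Lemma class_mulDl : left_distributive class_mul class_add.
Proof.
elim/iso_class_ind=> T1 to1; elim/iso_class_ind=> T2 to2.
elim/iso_class_ind=> T3 to3; rewrite !(class_addE, class_mulE).
apply/iso_classP.
exists (fun x => match x.1 with inl a => inl (a, x.2)
                 | inr b => inr (b, x.2) end).
  exists (fun x => match x with inl a => (inl a.1, a.2)
                   | inr b => (inr b.1, b.2) end).
    by case=> [[]].
  by case=> [[]|[]].
by case=> [[]].
Qed.

Lemma class_mul0 : left_zero class_zero class_mul.
Proof.
elim/iso_class_ind=> T to; rewrite class_mulE; apply/iso_classP.
exists fst; last by move=> [[]].
by exists (fun x : void => match x with end) => [[[]]|[]].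
Qed.

HB.instance Definition _ :=
  GRing.isNmodule.Build gset_class class_addA class_addC class_add0.
HB.instance Definition _ :=
  GRing.Nmodule_isComPzSemiRing.Build gset_class
    class_mulA class_mulC class_mul1 class_mulDl class_mul0.

Definition fixed_points (x : gset_class) : int :=
  #|'Fix_(class_act x)([set: gT])|%g%:Z.

Lemma gset_iso_fix (T1 T2 : finType)
    (to1 : {action gT &-> T1}) (to2 : {action gT &-> T2}) :
  gset_iso to1 to2 ->
  #|'Fix_to1([set: gT])%g| = #|'Fix_to2([set: gT])%g|.
Proof.
case=> f bf fE; have f_inj := bij_inj bf; case: (bf) => f' fK f'K.
rewrite -(card_imset _ f_inj); apply: eq_card => y.
apply/imsetP/afixP => [[x /afixP x_fix ->] g _ | y_fix].
  by rewrite -fE x_fix ?inE.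
exists (f' y); rewrite ?f'K //; apply/afixP => g _.
by apply: f_inj; rewrite fE f'K y_fix ?inE.
Qed.

Lemma fixed_pointsE (T : finType) (to : {action gT &-> T}) :
  fixed_points (iso_class to) = #|'Fix_to([set: gT])|%g%:Z.
Proof. by rewrite /fixed_points (gset_iso_fix (class_act_iso to)). Qed.

Lemma fixed_points_nmod_morphism : nmod_morphism fixed_points.
Proof.
split=> [|x y].
  by rewrite fixed_pointsE eq_card0 // => -[].
elim/iso_class_ind: x => T1 to1; elim/iso_class_ind: y => T2 to2.
rewrite [_ + _]class_addE !fixed_pointsE -PoszD; congr Posz.
rewrite -(card_imset 'Fix_to1(_)%g (@inl_inj T1 T2)).
rewrite -(card_imset 'Fix_to2(_)%g (@inr_inj T1 T2)).
rewrite -cardsUI (_ : _ :&: _ = set0) ?cards0 ?addn0.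
  apply: eq_card => -[x|x]; rewrite in_setU.
    rewrite (mem_imset _ _ (@inl_inj T1 T2)).
    have -> : (inl x \in [set inr z | z in 'Fix_to2([set: gT])%g]) = false.
      by apply/imsetP => -[].
    rewrite orbF; apply/afixP/afixP => fx g Gg; first by case: (fx g Gg).
    by rewrite /= fx.
  rewrite (mem_imset _ _ (@inr_inj T1 T2)).
  have -> : (inr x \in [set inl z | z in 'Fix_to1([set: gT])%g]) = false.
    by apply/imsetP => -[].
  rewrite orFb; apply/afixP/afixP => fx g Gg; first by case: (fx g Gg).
  by rewrite /= fx.
apply/setP => z; rewrite !inE; apply/negP.
by case/andP => /imsetP[u _ ->] /imsetP[v].
Qed.

Lemma fixed_points_monoid_morphism : monoid_morphism fixed_points.
Proof.
split=> [|x y].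
  rewrite fixed_pointsE (_ : 'Fix_(_)(_)%g = [set: unit]).
    by rewrite cardsT card_unit.
  by apply/setP => x; rewrite in_setT; apply/afixP.
elim/iso_class_ind: x => T1 to1; elim/iso_class_ind: y => T2 to2.
rewrite [_ * _]class_mulE !fixed_pointsE -PoszM -cardsX; congr Posz.
apply: eq_card => -[x y]; rewrite in_setX.
apply/afixP/andP => [fxy | [/afixP fx /afixP fy] g Gg]; last first.
  by rewrite /= /prod_act_fun /= fx // fy.
by split; apply/afixP => g Gg; case: (fxy g Gg).
Qed.

HB.instance Definition _ :=
  GRing.isNmodMorphism.Build gset_class int fixed_points
    fixed_points_nmod_morphism.
HB.instance Definition _ :=
  GRing.isMonoidMorphism.Build gset_class int fixed_points
    fixed_points_monoid_morphism.

End GSets.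

(* The Grothendieck ring of a commutative semiring M: pairs (x, y), standing
   for the formal difference x - y. *)

Section GroupCompletion.

Variable M : comPzSemiRingType.

Definition completion_rel (u v : M * M) : bool :=
  `[< exists z, u.1 + v.2 + z = v.1 + u.2 + z >].

Lemma completion_rel_refl : reflexive completion_rel.
Proof. by move=> u; apply/asboolP; exists 0. Qed.

Lemma completion_rel_sym : symmetric completion_rel.
Proof. by move=> u v; apply/asboolP/asboolP => -[z e]; exists z. Qed.

Lemma completion_rel_trans : transitive completion_rel.
Proof.
move=> [v1 v2] [u1 u2] [w1 w2] /asboolP[z /= uv] /asboolP[t /= vw].
apply/asboolP; exists (v2 + z + (v1 + t)) => /=.
transitivity ((u1 + v2 + z) + (v1 + w2 + t)); first by ring.
by rewrite uv vw; ring.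
Qed.

Canonical completion_rel_equiv :=
  EquivRel completion_rel completion_rel_refl completion_rel_sym
    completion_rel_trans.

Definition completion := {eq_quot completion_rel}.

HB.instance Definition _ := Choice.on completion.

Definition completion_pi (u : M * M) : completion := \pi_completion u.

Lemma completion_piP (u v : M * M) :
  completion_pi u = completion_pi v <->
  exists z, u.1 + v.2 + z = v.1 + u.2 + z.
Proof. by split=> [/eqmodP/asboolP | ?] //; apply/eqmodP/asboolP. Qed.

Lemma completion_reprK (x : completion) : completion_pi (repr x) = x.
Proof. exact: reprK. Qed.

Lemma completion_ind (P : completion -> Prop) :
  (forall x y, P (completion_pi (x, y))) -> forall x, P x.
Proof. by move=> Pp x; rewrite -(completion_reprK x); case: (repr x). Qed.

Definition completion_add_pair (u v : M * M) := (u.1 + v.1, u.2 + v.2).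

Definition completion_mul_pair (u v : M * M) :=
  (u.1 * v.1 + u.2 * v.2, u.1 * v.2 + u.2 * v.1).

Definition completion_opp_pair (u : M * M) := (u.2, u.1).

Definition completion_add (x y : completion) :=
  completion_pi (completion_add_pair (repr x) (repr y)).

Definition completion_mul (x y : completion) :=
  completion_pi (completion_mul_pair (repr x) (repr y)).

Definition completion_opp (x : completion) :=
  completion_pi (completion_opp_pair (repr x)).

Lemma completion_repr (u : M * M) :
  exists z, (repr (completion_pi u)).1 + u.2 + z
            = u.1 + (repr (completion_pi u)).2 + z.
Proof. by apply/completion_piP/completion_reprK. Qed.

Lemma completion_addE u v :
  completion_add (completion_pi u) (completion_pi v)
  = completion_pi (completion_add_pair u v).
Proof.
rewrite /completion_add; apply/completion_piP => /=.
have [z ez] := completion_repr u; have [t et] := completion_repr v.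
exists (z + t); move: (repr (completion_pi u)) (repr (completion_pi v)) ez et => [u1 u2] [v1 v2] /= ez et.
transitivity ((u1 + u.2 + z) + (v1 + v.2 + t)); first by ring.
by rewrite ez et; ring.
Qed.

Lemma completion_oppE u :
  completion_opp (completion_pi u) = completion_pi (completion_opp_pair u).
Proof.
rewrite /completion_opp; apply/completion_piP => /=.
have [z ez] := completion_repr u; exists z.
by rewrite [X in X + z]addrC -ez [X in _ = X + z]addrC.
Qed.

Lemma completion_mulE u v :
  completion_mul (completion_pi u) (completion_pi v)
  = completion_pi (completion_mul_pair u v).
Proof.
have [z ez] := completion_repr u; have [t et] := completion_repr v.
rewrite /completion_mul; apply/completion_piP.
move: (repr (completion_pi u)) (repr (completion_pi v)) ez et => [u1 u2] [v1 v2] /= ez et.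
case: u v ez et => [a b] [c d] /= ez et.
exists ((z * (v1 + v2)) + (t * (a + b)) + a * v1 + b * v1 + a * v2 + b * v2).
transitivity ((u1 + b + z) * v1 + (a + u2 + z) * v2
              + ((v1 + d + t) * a + (c + v2 + t) * b)); first by ring.
transitivity ((a + u2 + z) * v1 + (u1 + b + z) * v2
              + ((c + v2 + t) * a + (v1 + d + t) * b)); last by ring.
by rewrite ez et.
Qed.

Lemma completion_addA : associative completion_add.
Proof.
elim/completion_ind=> a b; elim/completion_ind=> c d.
elim/completion_ind=> e f; rewrite !completion_addE /completion_add_pair /=.
by rewrite !addrA.
Qed.

Lemma completion_addC : commutative completion_add.
Proof.
elim/completion_ind=> a b; elim/completion_ind=> c d.
by rewrite !completion_addE /completion_add_pair /= addrC [b + d]addrC.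
Qed.

Lemma completion_add0 : left_id (completion_pi (0, 0)) completion_add.
Proof.
elim/completion_ind=> a b.
by rewrite !completion_addE /completion_add_pair /= !add0r.
Qed.

Lemma completion_addN :
  left_inverse (completion_pi (0, 0)) completion_opp completion_add.
Proof.
elim/completion_ind=> a b; rewrite completion_oppE completion_addE.
by apply/completion_piP; exists 0 => /=; ring.
Qed.

Lemma completion_mulA : associative completion_mul.
Proof.
elim/completion_ind=> a b; elim/completion_ind=> c d.
elim/completion_ind=> e f; rewrite !completion_mulE /completion_mul_pair /=.
by congr (completion_pi (_, _)); ring.
Qed.

Lemma completion_mulC : commutative completion_mul.
Proof.
elim/completion_ind=> a b; elim/completion_ind=> c d.
rewrite !completion_mulE /completion_mul_pair /=.
by congr (completion_pi (_, _)); ring.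
Qed.

Lemma completion_mul1 : left_id (completion_pi (1, 0)) completion_mul.
Proof.
elim/completion_ind=> a b; rewrite !completion_mulE /completion_mul_pair /=.
by congr (completion_pi (_, _)); ring.
Qed.

Lemma completion_mulDl : left_distributive completion_mul completion_add.
Proof.
elim/completion_ind=> a b; elim/completion_ind=> c d.
elim/completion_ind=> e f; rewrite !(completion_mulE, completion_addE).
rewrite /completion_mul_pair /completion_add_pair /=.
by congr (completion_pi (_, _)); ring.
Qed.

HB.instance Definition _ :=
  GRing.isZmodule.Build completion
    completion_addA completion_addC completion_add0 completion_addN.
HB.instance Definition _ :=
  GRing.Zmodule_isComPzRing.Build completion
    completion_mulA completion_mulC completion_mul1 completion_mulDl.

Definition completion_in (x : M) : completion := completion_pi (x, 0).

Lemma completion_in_nmod_morphism : nmod_morphism completion_in.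
Proof.
split=> // x y.
by rewrite [_ + _ in RHS]completion_addE /completion_add_pair /= addr0.
Qed.

Lemma completion_in_monoid_morphism : monoid_morphism completion_in.
Proof.
split=> // x y; rewrite [_ * _ in RHS]completion_mulE.
by rewrite /completion_mul_pair /= !mulr0 mul0r !addr0.
Qed.

HB.instance Definition _ :=
  GRing.isNmodMorphism.Build M completion completion_in
    completion_in_nmod_morphism.
HB.instance Definition _ :=
  GRing.isMonoidMorphism.Build M completion completion_in
    completion_in_monoid_morphism.

Lemma completion_inP (x y : M) :
  completion_in x = completion_in y <-> exists z, x + z = y + z.
Proof. by split=> [/completion_piP|[z e]] /=; [|apply/completion_piP; exists z];
  rewrite !addr0. Qed.

Lemma completion_inB (x : completion) :
  exists y z, x = completion_in y - completion_in z.
Proof.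
elim/completion_ind: x => y z; exists y, z.
rewrite [- _]completion_oppE [_ + _ in RHS]completion_addE.
by rewrite /completion_add_pair /= addr0 add0r.
Qed.

(* The extension of f : M -> R to the group completion. *)
Definition completion_lift (R : comPzRingType) (f : {rmorphism M -> R})
    (x : completion) : R :=
  f (repr x).1 - f (repr x).2.

Section Lift.

Variables (R : comPzRingType) (f : {rmorphism M -> R}).

Lemma completion_lift_pi u :
  completion_lift f (completion_pi u) = f u.1 - f u.2.
Proof.
rewrite /completion_lift; have [z /(congr1 f)] := completion_repr u.
by rewrite !rmorphD => /addIr e; apply/eqP; rewrite subr_eq addrAC eq_sym subr_eq -e.
Qed.

Lemma completion_liftE x : completion_lift f (completion_in x) = f x.
Proof. by rewrite completion_lift_pi rmorph0 subr0. Qed.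

Lemma completion_lift_zmod_morphism : zmod_morphism (completion_lift f).
Proof.
elim/completion_ind=> a b; elim/completion_ind=> c d.
rewrite [- _ in LHS]completion_oppE [_ + _ in LHS]completion_addE.
by rewrite !completion_lift_pi /= !rmorphD; ring.
Qed.

Lemma completion_lift_monoid_morphism : monoid_morphism (completion_lift f).
Proof.
split; first by rewrite completion_liftE rmorph1.
elim/completion_ind=> a b; elim/completion_ind=> c d.
rewrite [_ * _ in LHS]completion_mulE.
by rewrite !completion_lift_pi /= !rmorphD !rmorphM; ring.
Qed.

HB.instance Definition _ :=
  GRing.isZmodMorphism.Build completion R (completion_lift f)
    completion_lift_zmod_morphism.
HB.instance Definition _ :=
  GRing.isMonoidMorphism.Build completion R (completion_lift f)
    completion_lift_monoid_morphism.

End Lift.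

End GroupCompletion.

Definition burnside (gT : finGroupType) : comPzRingType :=
  completion (gset_class gT).

Definition burnside_class (gT : finGroupType) (T : finType)
    (to : {action gT &-> T}) : burnside gT :=
  completion_in (iso_class to).

Lemma burnside_classD (gT : finGroupType) (T1 T2 : finType)
    (to1 : {action gT &-> T1}) (to2 : {action gT &-> T2}) :
  burnside_class (sum_act to1 to2) = burnside_class to1 + burnside_class to2.
Proof. by rewrite /burnside_class -rmorphD /= [_ + _]class_addE. Qed.

Lemma burnside_classM (gT : finGroupType) (T1 T2 : finType)
    (to1 : {action gT &-> T1}) (to2 : {action gT &-> T2}) :
  burnside_class (prod_act to1 to2) = burnside_class to1 * burnside_class to2.
Proof. by rewrite /burnside_class -rmorphM /= [_ * _]class_mulE. Qed.

Definition augmentation (gT : finGroupType) : {rmorphism burnside gT -> int} :=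
  completion_lift (@fixed_points gT).

Lemma augmentationE (gT : finGroupType) (T : finType)
    (to : {action gT &-> T}) :
  augmentation gT (burnside_class to) = #|'Fix_to([set: gT])|%g%:Z.
Proof. by rewrite /= completion_liftE /= fixed_pointsE. Qed.

Definition augmentation_ideal (gT : finGroupType) (x : burnside gT) : Prop :=
  augmentation gT x = 0.

Section Ideals.

Variable R : comPzRingType.
Implicit Types I J : R -> Prop.

Definition ideal_mul I J (x : R) : Prop :=
  exists2 s : seq (R * R), (forall u, u \in s -> I u.1 /\ J u.2)
                         & x = \sum_(u <- s) u.1 * u.2.

Fixpoint ideal_exp I (n : nat) : R -> Prop :=
  if n is n'.+1 then ideal_mul I (ideal_exp I n') else fun=> True.

End Ideals.

(* A is freely generated over Z by the family s; in particular the members of s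
   are pairwise distinct. *)
Definition int_basis (V : zmodType) (A : V -> Prop) (s : seq V) : Prop :=
  (forall x, A x <-> inIntSpan (in_tuple s) x) /\
  (forall c : int ^ size s,
     \sum_(i < size s) s`_i *~ c i = 0 -> forall i, c i = 0).

Section CosetClasses.

Variables (gT : finGroupType) (p : nat) (a b : gT).
Local Open Scope group_scope.

Definition subN (i : nat) : {set gT} := <[a ^+ (p ^ i)%N]>.

Definition subM (k l : nat) : {set gT} :=
  \bigcup_(j < p) ((b * a ^+ (l * p ^ k.-1)%N) ^+ j *: subN k).

Definition alpha (i : nat) : burnside gT := burnside_class (coset_act (subN i)).

Definition beta (k l : nat) : burnside gT :=
  burnside_class (coset_act (subM k l)).

End CosetClasses.

(* Main.v *)
From HB Require Import structures.
Require Import Defs.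
From mathcomp Require Import all_boot all_order all_algebra all_fingroup.
From mathcomp Require Import all_solvable ring.

Set Implicit Arguments.
Unset Strict Implicit.
Unset Printing Implicit Defensive.

Import GRing.Theory.
Local Open Scope ring_scope.

(** The coset classes [G/K] of the proper subgroups K, one for each conjugacy
    class, form a Z-basis of the augmentation ideal Delta: every finite G-set
    is a disjoint union of orbits G/K ([burnside_class_orbits]), G/K has no
    fixed point unless K = G, and the table of marks is triangular
    ([coset_class_free]). Everything else is a computation of products.

    If N is normal then [G/N] [G/K] = |G : NK| [G/(N :&: K)]
    ([coset_classM]). Let G be the modular group and N, K proper. When NK is
    proper, p divides the coefficient. When NK = G the coefficient is 1, but
    then N and K map to distinct lines of the plane G / Phi(G), so that
    N :&: K lies in Phi(G) = <[a ^+ p]> ([cap_sub_Phi]). Therefore Delta^2 is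
    contained in the lattice L spanned by the [G/K] with K inside Phi(G), which
    are the alpha_i with i > 0, and by the p [G/K] for the other K
    ([span_genM]). Conversely p [G/K] = [G/T] [G/K] for a maximal subgroup T
    containing K, and alpha_i = alpha_0 beta_i0, so that Delta^2 = L. Multiplying
    by Delta once more multiplies L by p: if K lies in Phi(G) then NK = G would
    force N = G, so p divides the coefficient of [G/N] [G/K]
    ([span_gen_PhiM]). Induction then gives Delta^(n+1) = p^(n-1) L
    for n > 0 ([ideal_exp_span]).

    The only class of nonnormal subgroups is that of B = <[b]>. There
    [G/B]^2 = c [G/B] + d [G/1], and counting the points fixed by B shows that
    c = |N(B) : B|, which p divides because normalisers grow in p-groups
    ([span_betaM]).

    The list of subgroups comes from the identity
    (b a^c)^p = a^(cp), valid for odd p ([expg_ba_p]): a subgroup K not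
    contained in <[a]> is <[b a^c]> (K :&: <[a]>) for some c, and this identity
    restricts c ([subgroup_code]). *)

(** * Orbit decomposition in the Burnside ring *)

Section Orbits.

Variable gT : finGroupType.
Implicit Types (K L N : {group gT}) (A : {set gT}).

Definition coset_class A : burnside gT := burnside_class (coset_act A).

Lemma coset_point_subproof A x : (x *: A)%g \in lcosets A [set: gT].
Proof. by apply/lcosetsP; exists x. Qed.

Definition coset_point A x : coset_space A :=
  exist (fun X : {set gT} => X \in lcosets A [set: gT]) (x *: A)%g
    (coset_point_subproof A x).

Lemma iso_burnside_class (T1 T2 : finType)
    (to1 : {action gT &-> T1}) (to2 : {action gT &-> T2}) :
  gset_iso to1 to2 -> burnside_class to1 = burnside_class to2.
Proof. by move=> iso12; congr completion_in; apply/iso_classP. Qed.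

Lemma bij_of_surj (T1 T2 : finType) (f : T1 -> T2) :
  injective f -> (forall y, exists x, f x = y) -> bijective f.
Proof.
move=> f_inj f_surj; apply: inj_card_bij => //.
rewrite -(card_codom f_inj); apply: subset_leq_card; apply/subsetP=> y _.
by have [x <-] := f_surj y; apply: codom_f.
Qed.

Section SubGset.

Variables (T : finType) (to : {action gT &-> T}) (P : {pred T}).
Hypothesis stableP : forall x g, (to x g \in P) = (x \in P).

Lemma sub_act_subproof (x : {x | x \in P}) g : to (val x) g \in P.
Proof. by rewrite stableP (valP x). Qed.

Definition sub_act_fun (x : {x | x \in P}) g : {x | x \in P} :=
  exist _ (to (val x) g) (sub_act_subproof x g).

Lemma sub_act1 : sub_act_fun^~ 1%g =1 id.
Proof. by move=> x; apply: val_inj; rewrite /= act1. Qed.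

Lemma sub_actM : forall x, act_morph sub_act_fun x.
Proof. by move=> x g h; apply: val_inj; rewrite /= actM. Qed.

Definition sub_act : {action gT &-> {x | x \in P}} :=
  TotalAction sub_act1 sub_actM.

End SubGset.

Lemma burnside_class_split (T : finType) (to : {action gT &-> T})
    (P : {pred T}) (sP : forall x g, (to x g \in P) = (x \in P))
    (sP' : forall x g, (to x g \in [predC P]) = (x \in [predC P])) :
  burnside_class to =
    burnside_class (sub_act sP) + burnside_class (sub_act sP').
Proof.
rewrite -burnside_classD; apply/esym/iso_burnside_class.
pose f (z : {x | x \in P} + {x | x \in [predC P]}) : T :=
  match z with inl x => val x | inr y => val y end.
exists f; last by case.
apply: bij_of_surj => [[x|x] [y|y] /= e|x].
- by congr inl; apply: val_inj.
- by have := valP y; rewrite /= inE /= -e (valP x).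
- by have := valP x; rewrite /= inE /= e (valP y).
- by congr inr; apply: val_inj.
have [Px|Px] := boolP (x \in P); first by exists (inl (exist _ x Px)).
have Px' : x \in [predC P] by [].
by exists (inr (exist _ x Px')).
Qed.

(** The coset gS of the stabiliser S of x corresponds to the point g . x, which
    is [to x g^-1] for a right action. *)
Lemma transitive_coset_class (T : finType) (to : {action gT &-> T}) x :
  (forall y, exists g, y = to x g) ->
  burnside_class to = coset_class 'C[x | to]%g.
Proof.
move=> tr; apply/esym/iso_burnside_class.
pose f (X : coset_space 'C[x | to]%g) := to x (repr (val X))^-1%g.
have fE (X : coset_space 'C[x | to]%g) g : g \in val X -> f X = to x g^-1%g.
  have /lcosetsP[h _ hX] := valP X.
  rewrite hX => Xg; rewrite /f hX.
  have stabV u : u \in 'C[x | to]%g -> to x u^-1%g = x.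
    by rewrite -groupV => /astab1P.
  have: repr (h *: 'C[x | to])%g \in (h *: 'C[x | to])%g by apply: mem_repr Xg.
  case/lcosetP: Xg => u xu ->; case/lcosetP => v xv ->.
  by rewrite !invMg !actM (stabV u xu) (stabV v xv).
have repX (X : coset_space 'C[x | to]%g) : repr (val X) \in val X.
  have /lcosetsP[h _ hX] := valP X.
  by rewrite hX; apply: mem_repr (lcoset_refl _ h).
exists f => [|X g]; last first.
  rewrite (fE _ (g^-1 * repr (val X))%g).
    by rewrite (fE _ _ (repX X)) invMg invgK actM.
  by rewrite /= mem_lcoset invgK mulKVg repX.
apply: bij_of_surj => [X Y e|y].
  apply: val_inj; have := repX X; have := repX Y; move: e; rewrite /f.
  move: (repr _) (repr _) => g h.
  have /lcosetsP[h1 _ ->] := valP X; have /lcosetsP[h2 _ ->] := valP Y.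
  move=> e /lcoset_eqP<- /lcoset_eqP<-; apply/lcoset_eqP.
  rewrite mem_lcoset; apply/astab1P.
  by rewrite actM -e -actM mulVg act1.
have [g ->] := tr y.
exists (coset_point 'C[x | to]%g g^-1%g); rewrite (fE _ g^-1%g) ?invgK //=.
exact: lcoset_refl.
Qed.

(** The sequence X picks one point in every orbit; split off the orbit of a
    point and induct on the number of points. *)
Lemma burnside_class_orbits (T : finType) (to : {action gT &-> T}) :
  exists X : seq T,
    burnside_class to = \sum_(x <- X) coset_class 'C[x | to]%g.
Proof.
have [n] := ubnP #|T|; elim: n T to => // n IHn T to /ltnSE leTn.
have [x _|T0] := pickP (@predT T); last first.
  exists [::]; rewrite big_nil -(rmorph0 (@completion_in _)).
  apply/esym/iso_burnside_class.
  by exists (of_void T) => [|[]]; apply: bij_of_surj => [[]|x]; have := T0 x.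
pose P := [pred y | y \in orbit to [set: gT] x]%g.
have sP y g : (to y g \in P) = (y \in P).
  by rewrite !inE orbit_actr ?inE.
have sP' y g : (to y g \in [predC P]) = (y \in [predC P]).
  by rewrite !inE (sP y g).
have Px : x \in P by rewrite inE orbit_refl.
have ltT : (#|{: {y | y \in [predC P]}}| < n)%N.
  rewrite card_sig; apply: leq_trans leTn; apply: proper_card.
  by apply/properP; split; [apply/subsetP|exists x; rewrite ?inE ?negbK ?orbit_refl].
have [X defX] := IHn _ (sub_act sP') ltT.
exists (x :: map val X).
rewrite (burnside_class_split sP sP') defX big_cons big_map; congr (_ + _).
  rewrite (transitive_coset_class (x := exist _ x Px)) => [|y]; last first.
    have /orbitP[g _ yg] : val y \in orbit to [set: gT] x by have := valP y.
    by exists g; apply: val_inj.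
  congr coset_class; apply/setP=> g.
  by apply/astab1P/astab1P => [/(congr1 val)|e]; last apply: val_inj.
apply: eq_bigr => y _; congr coset_class; apply/setP=> g.
by apply/astab1P/astab1P => [/(congr1 val)|e]; last apply: val_inj.
Qed.

Lemma astab1_coset K (X : coset_space K) g :
  g \in val X -> ('C[X | coset_act K] = K :^ g^-1)%g.
Proof.
have /lcosetsP[h _ hX] := valP X; rewrite hX => /lcoset_eqP e.
apply/setP=> u; rewrite mem_conjgV.
have -> : (u \in 'C[X | coset_act K]%g) = (u^-1 *: val X == val X)%g.
  by apply/astab1P/eqP => [/(congr1 val)|e']; last apply: val_inj.
rewrite hX -e -lcosetM -[RHS]groupV -conjVg conjgE.
by apply/eqP/idP => [/lcoset_eqP|Ku]; [|apply/lcoset_eqP]; rewrite mem_lcoset.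
Qed.

Lemma astab1_coset_point K x :
  ('C[coset_point K x | coset_act K] = K :^ x^-1)%g.
Proof. by apply: astab1_coset; apply: lcoset_refl. Qed.

(** G/K is also the orbit of the coset [x^-1 K], whose stabiliser is [K :^ x]. *)
Lemma coset_class_conj K x : coset_class (K :^ x)%g = coset_class K.
Proof.
rewrite [RHS](transitive_coset_class (x := coset_point K x^-1%g)) => [|X].
  by rewrite astab1_coset_point invgK.
have /lcosetsP[h _ hX] := valP X; exists (x^-1 * h^-1)%g.
by apply: val_inj; rewrite /= hX -lcosetM; congr (_ *: _)%g; rewrite invMg invgK mulgKV.
Qed.

Lemma coset_classT : coset_class [set: gT] = 1.
Proof.
rewrite -(rmorph1 (@completion_in _)); apply: iso_burnside_class.
exists (fun=> tt) => //; apply: bij_of_surj => [X Y _|[]]; last first.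
  by exists (coset_point _ 1%g).
apply: val_inj.
have /lcosetsP[x _ ->] := valP X; have /lcosetsP[y _ ->] := valP Y.
by rewrite !lcoset_id ?inE.
Qed.

(** * Marks and the independence of coset classes *)

Section Marks.

Variable A : {set gT}.

Definition fixed_card (x : gset_class gT) : int :=
  #|'Fix_(class_act x)(A)|%g%:Z.

Lemma gset_iso_fixed_card (T1 T2 : finType)
    (to1 : {action gT &-> T1}) (to2 : {action gT &-> T2}) :
  gset_iso to1 to2 -> #|'Fix_to1(A)%g| = #|'Fix_to2(A)%g|.
Proof.
case=> f bf fE; have f_inj := bij_inj bf; case: (bf) => f' fK f'K.
rewrite -(card_imset _ f_inj); apply: eq_card => y.
apply/imsetP/afixP => [[x /afixP x_fix ->] g Ag | y_fix].
  by rewrite -fE x_fix.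
exists (f' y); rewrite ?f'K //; apply/afixP => g Ag.
by apply: f_inj; rewrite fE f'K y_fix.
Qed.

Lemma fixed_cardE (T : finType) (to : {action gT &-> T}) :
  fixed_card (iso_class to) = #|'Fix_to(A)|%g%:Z.
Proof. by rewrite /fixed_card (gset_iso_fixed_card (class_act_iso to)). Qed.

Lemma fixed_card_nmod_morphism : nmod_morphism fixed_card.
Proof.
split=> [|x y]; first by rewrite fixed_cardE eq_card0 // => -[].
elim/iso_class_ind: x => T1 to1; elim/iso_class_ind: y => T2 to2.
rewrite [_ + _]class_addE !fixed_cardE -PoszD; congr Posz.
rewrite -!sum1_card !(big_mkcond (fun x => x \in _)) big_sumType /=.
congr (_ + _)%N; apply: eq_bigr => x _; congr (if _ then _ else _);
  by apply/afixP/afixP => fx g Ag; [case: (fx g Ag)|rewrite /= fx].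
Qed.

Lemma fixed_card_monoid_morphism : monoid_morphism fixed_card.
Proof.
split=> [|x y].
  rewrite fixed_cardE (_ : 'Fix_(_)(_)%g = [set: unit]).
    by rewrite cardsT card_unit.
  by apply/setP => x; rewrite in_setT; apply/afixP.
elim/iso_class_ind: x => T1 to1; elim/iso_class_ind: y => T2 to2.
rewrite [_ * _]class_mulE !fixed_cardE -PoszM -cardsX; congr Posz.
apply: eq_card => -[x y]; rewrite in_setX.
apply/afixP/andP => [fxy | [/afixP fx /afixP fy] g Ag]; last first.
  by rewrite /= /prod_act_fun /= fx // fy.
by split; apply/afixP => g Ag; case: (fxy g Ag).
Qed.

HB.instance Definition _ :=
  GRing.isNmodMorphism.Build (gset_class gT) int fixed_card
    fixed_card_nmod_morphism.
HB.instance Definition _ :=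
  GRing.isMonoidMorphism.Build (gset_class gT) int fixed_card
    fixed_card_monoid_morphism.

Definition mark : {rmorphism burnside gT -> int} := completion_lift fixed_card.

Lemma markE (T : finType) (to : {action gT &-> T}) :
  mark (burnside_class to) = #|'Fix_to(A)|%g%:Z.
Proof. by rewrite /= completion_liftE /= fixed_cardE. Qed.

End Marks.

Lemma mark_coset_class_sub A K : mark A (coset_class K) != 0 ->
  exists x, A \subset (K :^ x)%g.
Proof.
rewrite markE; have [->|[X /afixP fixX] _] := set_0Vmem 'Fix_(coset_act K)(A)%g.
  by rewrite cards0.
have /lcosetsP[x _ hX] := valP X; exists x^-1%g; apply/subsetP=> g Ag.
rewrite -(@astab1_coset _ X) ?hX ?lcoset_refl //.
by apply/astab1P; apply: fixX.
Qed.

(** A coset xK is fixed by K exactly when x normalises K. *)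
Lemma mark_coset_class_self K :
  mark K (coset_class K) = #|'N(K) : K|%g%:Z.
Proof.
rewrite markE -card_lcosets -(card_imset _ val_inj); congr Posz.
apply: eq_card => Y; apply/imsetP/lcosetsP => [[X fixX ->]|[x Nx ->]].
  have /lcosetsP[x _ hX] := valP X; exists x => //.
  have Xx : x \in val X by rewrite hX lcoset_refl.
  rewrite inE sub_conjg -(astab1_coset Xx).
  by apply/subsetP=> g Kg; apply/astab1P; move/afixP: fixX; apply.
exists (coset_point K x) => //; apply/afixP => g Kg.
apply: (astab1P (to := coset_act K)).
by rewrite astab1_coset_point (normP _) ?groupV.
Qed.

Lemma mark1_coset_class K : mark 1%g (coset_class K) = #|[set: gT] : K|%g%:Z.
Proof.
rewrite markE -card_lcosets -(card_imset _ val_inj); congr Posz.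
apply: eq_card => Y; apply/imsetP/idP => [[X _ ->]|lY]; first exact: valP.
exists (exist (fun Y : {set gT} => Y \in lcosets K [set: gT]) Y lY) => //.
by apply/afixP => g /set1P->; rewrite act1.
Qed.

(** Burnside: the table of marks is triangular with nonzero diagonal when
    subgroups are listed by size, so pairwise nonconjugate subgroups have
    linearly independent coset classes. *)
Lemma coset_class_free (I : finType) (K : I -> {group gT}) (c : I -> int) :
  (forall i j x, K i :=: (K j :^ x)%g -> i = j) ->
  \sum_i coset_class (K i) *~ c i = 0 -> forall i, c i = 0.
Proof.
move=> Kinj sum0 i0; apply/eqP/idPn => ci0.
(* A largest K i with c i != 0 only fixes points of its own coset space. *)
case: (arg_maxnP (P := fun i => c i != 0) (fun i => #|K i|) ci0) => i ci max_i.
have := congr1 (mark (K i)) sum0; rewrite rmorph_sum rmorph0 (bigD1 i) //= big1.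
  rewrite addr0 rmorphMz /= mark_coset_class_self => /eqP.
  rewrite -mulrzr mulf_eq0 intr_eq0 (negPf ci) orbF.
  by rewrite eqz_nat -leqn0 leqNgt indexg_gt0.
move=> j ji; rewrite rmorphMz.
have [->|cj] := eqVneq (c j) 0; first by rewrite mulr0z.
have [->|/mark_coset_class_sub[x sKx]] := eqVneq (mark (K i) (coset_class (K j))) 0.
  by rewrite mul0rz.
case/eqP: ji; apply/esym/(Kinj _ _ x)/eqP.
by rewrite eqEcard sKx cardJg; apply: max_i.
Qed.

(** All stabilisers in G/N x G/K are conjugates of N :&: K, so all orbits are
    isomorphic and counting points gives their number. *)
Lemma coset_classM N K : (N <| [set: gT])%g ->
  coset_class N * coset_class K =
    coset_class (N :&: K)%g *+ #|[set: gT] : N <*> K|%g.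
Proof.
move=> nN; have [X defX] :=
  burnside_class_orbits (prod_act (coset_act N) (coset_act K)).
have {defX} defX : coset_class N * coset_class K = coset_class (N :&: K)%g *+ size X.
  rewrite -burnside_classM defX.
  have -> n u : u *+ n = iter n (+%R u) 0 :> burnside gT by rewrite iter_addr_0.
  rewrite -[size X]count_predT -big_const_seq.
  apply: eq_bigr => -[Y Z] _.
  have /lcosetsP[y _ hY] := valP Y; have /lcosetsP[z _ hZ] := valP Z.
  rewrite -(coset_class_conj (N :&: K) z^-1); congr coset_class.
  have -> : ('C[(Y, Z) | prod_act (coset_act N) (coset_act K)] =
             'C[Y | coset_act N] :&: 'C[Z | coset_act K])%g.
    apply/setP=> g; apply/astab1P/setIP => [[/= e1 e2]|[/astab1P e1 /astab1P e2]].
      by split; apply/astab1P.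
    by exact: (congr2 pair e1 e2).
  rewrite (astab1_coset (g := y)) ?hY ?lcoset_refl //.
  rewrite (astab1_coset (g := z)) ?hZ ?lcoset_refl // conjIg.
  by congr (_ :&: _); rewrite !(normsP (normal_norm nN)) ?inE.
rewrite defX; congr (_ *+ _).
(* The mark at the trivial group counts points. *)
have := congr1 (mark 1%g) defX.
rewrite rmorphM rmorphMn /= !mark1_coset_class -PoszM -mulr_natr natz -PoszM.
case=> e; apply/eqP; rewrite -(eqn_pmul2r (cardG_gt0 (N <*> K)%G)).
rewrite [X in _ == X]mulnC Lagrange ?subsetT //=.
rewrite norm_joinEr ?(subset_trans (subsetT K) (normal_norm nN)) //.
have [[gN gK] gI] := (Lagrange (subsetT N), Lagrange (subsetT K),
  Lagrange (subsetT (N :&: K)%G)).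
rewrite -(eqn_pmul2r (cardG_gt0 [set: gT])) -[X in (_ * X == _)%N]gI.
have mulACD (s q i d : nat) : (s * q * (i * d) = (q * i) * (d * s))%N by ring.
rewrite mulACD -(mul_cardG N K) -e -{1}gN -gK.
by apply/eqP; ring.
Qed.

End Orbits.

(** * Integral spans and powers of ideals *)

Section IntSpan.

Variable V : zmodType.
Implicit Types (s : seq V) (P : V -> Prop).

(** Additive subgroups of V, as Prop-valued predicates. *)
Definition zmod_pred P := P 0 /\ forall x y, P x -> P y -> P (x - y).

Lemma zmod_predN P x : zmod_pred P -> P x -> P (- x).
Proof. by case=> P0 PB Px; rewrite -sub0r; apply: PB. Qed.

Lemma zmod_predD P x y : zmod_pred P -> P x -> P y -> P (x + y).
Proof.
by move=> Pz Px Py; rewrite -[y]opprK; apply: Pz.2 => //; apply: zmod_predN.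
Qed.

Lemma zmod_predMn P x n : zmod_pred P -> P x -> P (x *+ n).
Proof.
move=> Pz Px; elim: n => [|n IHn]; first exact: Pz.1.
by rewrite mulrS; apply: zmod_predD.
Qed.

Lemma zmod_predMz P x n : zmod_pred P -> P x -> P (x *~ n).
Proof.
move=> Pz Px; case: n => n; first exact: zmod_predMn.
by rewrite NegzE mulrNz; apply: zmod_predN => //; apply: zmod_predMn.
Qed.

Lemma zmod_pred_sum P I (r : seq I) (F : I -> V) :
  zmod_pred P -> (forall i, P (F i)) -> P (\sum_(i <- r) F i).
Proof.
move=> Pz PF; elim/big_rec: _ => [|i x _]; first exact: Pz.1.
exact: zmod_predD.
Qed.

Lemma int_span_zmod s : zmod_pred (inIntSpan (in_tuple s)).
Proof.
split=> [|_ _ [a ->] [c ->]].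
  by exists [ffun=> 0]; rewrite big1 // => i _; rewrite ffunE mulr0z.
exists [ffun i => a i - c i]; rewrite -sumrB.
by apply: eq_bigr => i _; rewrite ffunE mulrzBr.
Qed.

Lemma mem_int_span s x : x \in s -> inIntSpan (in_tuple s) x.
Proof.
move=> sx; have ltxs : (index x s < size s)%N by rewrite index_mem.
exists [ffun i => (i == Ordinal ltxs)%:Z].
rewrite (bigD1 (Ordinal ltxs)) //= big1 ?addr0 => [|i /negPf ne].
  by rewrite ffunE eqxx nth_index.
by rewrite ffunE ne mulr0z.
Qed.

Lemma int_span_ind s P : zmod_pred P -> {in s, forall x, P x} ->
  forall x, inIntSpan (in_tuple s) x -> P x.
Proof.
move=> Pz Ps _ [c ->]; apply: zmod_pred_sum => // i.
by apply: zmod_predMz => //; apply/Ps/mem_nth.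
Qed.

End IntSpan.

Section IdealPowers.

Variables (R : comPzRingType) (I : R -> Prop).
Hypothesis I_zmod : zmod_pred I.

Lemma ideal_exp_zmod n : zmod_pred (ideal_exp I n).
Proof.
case: n => [|n] //; split.
  by exists [::] => //; rewrite big_nil.
move=> x y [s Is ->] [t It ->].
exists (s ++ [seq (- u.1, u.2) | u <- t]) => [u|].
  rewrite mem_cat => /orP[/Is//|/mapP[v /It[I1 I2] ->]].
  by split=> //; apply: zmod_predN.
rewrite big_cat big_map /= -sumrN; congr (_ + _).
by apply: eq_bigr => u _; rewrite mulNr.
Qed.

Lemma ideal_expS_ind n (P : R -> Prop) : zmod_pred P ->
  (forall x y, I x -> ideal_exp I n y -> P (x * y)) ->
  forall x, ideal_exp I n.+1 x -> P x.
Proof.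
move=> Pz PM _ [s Is ->]; rewrite big_seq.
elim/big_rec: _ => [|u y us Py]; first exact: Pz.1.
by apply: zmod_predD => //; have [] := Is u us; apply: PM.
Qed.

Lemma ideal_expSM n x y : I x -> ideal_exp I n y -> ideal_exp I n.+1 (x * y).
Proof.
by move=> Ix Iy; exists [:: (x, y)] => [u /[1!inE]/eqP->|]; rewrite ?big_seq1.
Qed.

End IdealPowers.

Lemma augmentation_ideal_zmod gT : zmod_pred (@augmentation_ideal gT).
Proof.
split=> [|x y]; rewrite /augmentation_ideal ?rmorph0 // rmorphB => -> ->.
by rewrite subr0.
Qed.

Lemma augmentation_coset_class (gT : finGroupType) (K : {group gT}) :
  K \proper [set: gT] -> augmentation_ideal (coset_class K).
Proof.
move=> pK; rewrite /augmentation_ideal augmentationE -markE; apply/eqP/idPn.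
case/mark_coset_class_sub=> x; rewrite -(conjGid (in_setT x)) conjSg => sGK.
by case/properP: pK => _ [y _ /negP]; case; apply: (subsetP sGK); rewrite inE.
Qed.

(** * Products of coset classes in p-groups *)

Section PGroup.

Variables (p : nat) (gT : finGroupType).
Implicit Types K L T : {group gT}.
Local Notation G := [set: gT].
Hypothesis pG : (p.-group G)%g.

Lemma p_dvd_index K L : K \proper L -> (p %| #|L : K|%g)%N.
Proof.
move=> pKL; have sKL := proper_sub pKL.
have pL : (p.-group L)%g := pgroupS (subsetT L) pG.
have [k iLK] := p_natP (pnat_dvd (dvdn_indexg L K) pL).
have ltk : (0 < k)%N.
  rewrite lt0n; apply: contraL pKL => /eqP k0; rewrite k0 expn0 in iLK.
  by rewrite properE sKL /= -indexg_eq1 iLK.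
by rewrite iLK dvdn_exp.
Qed.

(** The Frattini quotient is a plane, in which two distinct lines meet
    trivially. *)
Lemma cap_sub_Phi K L :
    #|G : 'Phi(G)|%g = (p ^ 2)%N -> K \proper G -> L \proper G ->
  (K <*> L = G)%g -> (K :&: L \subset 'Phi(G))%g.
Proof.
move=> iPhi pK pL KL.
have Phi_proper (M : {group gT}) : M \proper G -> (M <*> 'Phi(G))%g \proper G.
  move=> pM; rewrite properE subsetT; apply: contraL pM => sGM.
  rewrite properE subsetT /= negbK -(genGid M) (@Phi_nongen _ G) //.
  by apply/eqP; rewrite eqEsubset subsetT joingC.
set T := (K <*> 'Phi(G))%G; set U := (L <*> 'Phi(G))%G.
have [pT pU] : T \proper G /\ U \proper G by split; apply: Phi_proper.
have nT : (T <| G)%g.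
  rewrite sub_der1_normal ?subsetT // (subset_trans _ (joing_subr _ _)) //.
  by rewrite (Phi_joing pG) joing_subl.
have TU : (T * U = G)%g.
  apply/eqP; rewrite eqEsubset subsetT /= -norm_joinEr; last first.
    exact: subset_trans (subsetT U) (normal_norm nT).
  rewrite -{1}KL join_subG (subset_trans _ (joing_subl T U)) ?joing_subl //.
  by rewrite (subset_trans _ (joing_subr T U)) ?joing_subl.
have le_index (M : {group gT}) : M \proper G -> (p * #|M| <= #|G|)%N.
  move=> pM; rewrite -(Lagrange (subsetT M)) mulnC leq_mul2l.
  by rewrite dvdn_leq ?indexg_gt0 ?p_dvd_index ?orbT.
(* |TU| |T :&: U| = |T| |U|, where T and U have index at least p. *)
have le_cap : (#|T :&: U| <= #|'Phi(G)%g|)%N.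
  have := leq_mul (le_index T pT) (le_index U pU).
  rewrite mulnACA mul_cardG TU mulnCA leq_pmul2l ?cardG_gt0 //.
  rewrite -(Lagrange (Phi_sub G)) iPhi mulnn [X in (_ <= X)%N]mulnC leq_pmul2l //.
  by rewrite expn_gt0; have := indexg_gt0 G 'Phi(G)%g; rewrite iPhi expn_gt0.
have /eqP -> : 'Phi(G)%g == T :&: U.
  by rewrite eqEcard le_cap subsetI !joing_subr.
by apply: setISS; apply: joing_subl.
Qed.

End PGroup.

(** * Subgroups of the modular p-group *)

Section ModularGroup.

Variables (p m : nat) (gT : finGroupType) (a b : gT).
Hypotheses (p_prime : prime p) (p_odd : odd p) (m_ge3 : (3 <= m)%N).
Local Notation G := [set: gT].
Local Notation r := (p ^ m.-1)%N.
Hypothesis H_presented :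
  ([set: gT] \isog Grp (x : y : x ^+ (p ^ m)%N, y ^+ p,
                                x ^ y = x ^+ (r + 1)%N))%g.
Hypotheses (ab_gen : (<<[set a; b]>> = G)%g) (a_pow : (a ^+ (p ^ m)%N = 1)%g)
  (b_pow : (b ^+ p = 1)%g) (ab_rel : (b^-1 * a * b = a ^+ (r + 1)%N)%g).

Local Open Scope group_scope.

Let m_gt0 : (0 < m)%N. Proof. exact: leq_trans m_ge3. Qed.
Let p_gt0 : (0 < p)%N. Proof. exact: prime_gt0. Qed.
Let p_gt1 : (1 < p)%N. Proof. exact: prime_gt1. Qed.

(** Two groups with the same presentation are quotients of each other. *)
Lemma modular_isog : G \isog 'Mod_(p ^ m.+1).
Proof.
have m1 : (m.+1 > 2)%N by apply: leq_trans m_ge3 _.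
have := Grp_modular_group p_prime m1; rewrite /= -[(p ^ _).+1]addn1 => isoM.
apply/(isoGrpP _ isoM); split; last exact: isoGrp_hom H_presented.
apply/eqP; rewrite eqn_dvd; apply/andP; split; last first.
  by apply: card_homg; rewrite H_presented; apply: isoGrp_hom isoM.
by apply: card_homg; rewrite isoM; apply: isoGrp_hom H_presented.
Qed.

Lemma card_modular : #|G| = (p ^ m.+1)%N.
Proof.
rewrite (card_isog modular_isog) card_modular_group //.
exact: leq_trans m_ge3 _.
Qed.

Lemma modular_pgroup : p.-group G.
Proof. by rewrite /pgroup card_modular pnatX pnat_id. Qed.

Lemma mulG_ab : <[a]> * <[b]> = G.
Proof.
have nAB : <[b]> \subset 'N(<[a]>).
  by rewrite cycle_subG inE -cycleJ cycle_subG conjgE mulgA ab_rel mem_cycle.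
rewrite -norm_joinEr // -ab_gen; apply/eqP.
rewrite eqEsubset join_subG !cycle_subG gen_subG subUset !sub1set.
rewrite !mem_gen ?inE ?eqxx ?orbT //= -!cycle_subG ?subxx ?orbT //.
Qed.

Lemma order_ab : #[a] = (p ^ m)%N /\ #[b] = p.
Proof.
have da : (#[a] %| p ^ m)%N by rewrite order_dvdn a_pow.
have db : (#[b] %| p)%N by rewrite order_dvdn b_pow.
have le : (p ^ m * p <= #[a] * #[b])%N.
  rewrite -expnSr -card_modular -mulG_ab; apply: dvdn_leq (dvdn_cardMg _ _).
  by rewrite muln_gt0 !order_gt0.
have [la lb] : (#[a] <= p ^ m)%N /\ (#[b] <= p)%N.
  by split; apply: dvdn_leq => //; rewrite expn_gt0 p_gt0.
split; apply/eqP; rewrite eqn_leq ?la ?lb /=.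
  by rewrite -(leq_pmul2r p_gt0) (leq_trans le) // leq_mul2l lb orbT.
rewrite -(leq_pmul2l (_ : 0 < p ^ m)%N) ?expn_gt0 ?p_gt0 // (leq_trans le) //.
by rewrite leq_mul2r la orbT.
Qed.

Lemma modular_facts :
  [/\ <[a]> ><| <[b]> = G, 'Phi(G) = <[a ^+ p]>, 'Z(G) = <[a ^+ p]>
     & G^`(1) = <[a ^+ r]>].
Proof.
have m1 : (m.+1 > 2)%N by apply: leq_trans m_ge3 _.
have [oa ob] := order_ab.
have genG : extremal_generators G p m.+1 (a, b).
  split; rewrite ?card_modular ?inE //= andbT; apply/negP => Ab.
  have sBA : <[b]> \subset <[a]> by rewrite cycle_subG.
  have := card_modular; rewrite -mulG_ab (mulGidPl sBA) -orderE oa.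
  by move/eqP; rewrite eqn_exp2l // ltn_eqF.
have abJ : #[b] = p /\ a ^ b = a ^+ r.+1 by split; rewrite // conjgE mulgA ab_rel addn1.
case: (modular_group_structure p_prime m1 genG modular_isog abJ).
by case=> defG _ _ [defZ defPhi _] [defG' _ _] _ _; rewrite defPhi defZ.
Qed.

Lemma expg_ba c i :
  exists2 x, x \in <[a]> & (b * a ^+ c) ^+ i = b ^+ i * x.
Proof.
have [/sdprodP[_ _ nAB _] _ _ _] := modular_facts.
elim: i => [|i [x Ax IHi]]; first by exists 1; rewrite ?group1 // mulg1.
exists (x ^ b * a ^+ c).
  by rewrite groupM ?mem_cycle // memJ_norm // (subsetP nAB) ?cycle_id.
by rewrite expgSr IHi expgSr conjgE !mulgA mulgK.
Qed.

(** The commutator of [a ^+ c] and [b] is central of order dividing p, and p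
    divides 'C(p, 2) because p is odd. *)
Lemma expg_ba_p c : (b * a ^+ c) ^+ p = a ^+ (c * p).
Proof.
have [_ _ defZ defG'] := modular_facts.
have G'z : [~ a ^+ c, b] \in <[a ^+ r]>.
  by rewrite -defG' mem_commg ?inE.
have Zz : [~ a ^+ c, b] \in 'Z(G).
  rewrite defZ; apply: subsetP G'z; rewrite cycle_subG.
  have m1_gt0 : (0 < m.-1)%N by rewrite -ltnS prednK // (leq_trans _ m_ge3).
  by rewrite -(prednK m1_gt0) expnS expgM mem_cycle.
have Zc y : commute y [~ a ^+ c, b].
  by have /centerP[_ cz] := Zz; apply/esym/cz; rewrite inE.
rewrite expMg_Rmul // b_pow mul1g -expgM.
have [q ->] : exists q, 'C(p, 2) = (p * q)%N.
  by exists (p.-1)./2; apply: bin2odd.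
rewrite [_ ^+ (p * q)]expgM -[[~ _, _] ^+ p](_ : 1 = _) ?expg1n ?mulg1 //.
have /cycleP[j ->] := G'z.
rewrite -!expgM mulnCA -expnSr (ltn_predK m_gt0) mulnC expgM.
by rewrite a_pow expg1n.
Qed.

(** Subgroups of the cyclic group <[a]> are the <[a ^+ (p ^ i)]>. *)
Lemma cycle_subgroups (K : {group gT}) : K \subset <[a]> ->
  exists2 i, (i <= m)%N & K :=: <[a ^+ (p ^ i)]>.
Proof.
have [oa _] := order_ab => sKA.
have := cardSg sKA; rewrite -orderE oa => /(dvdn_pfactor _ _ p_prime)[j lej oK].
exists (m - j)%N; first exact: leq_subr.
apply/eqP; rewrite (eq_subG_cyclic (cycle_cyclic a)) ?cycleX // oK.
rewrite -orderE orderXdiv oa ?dvdn_exp2l ?leq_subr //.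
by rewrite -expnB ?leq_subr // subKn.
Qed.

Lemma card_cycle_p i : (i <= m)%N -> #|<[a ^+ (p ^ i)]>| = (p ^ (m - i))%N.
Proof.
have [oa _] := order_ab => lei.
by rewrite -orderE orderXdiv oa ?dvdn_exp2l // expnB.
Qed.

Lemma cycle_p_normal i : <[a ^+ (p ^ i)]> <| G.
Proof.
have [/sdprod_context[nA _ _ _ _] _ _ _] := modular_facts.
by apply: char_normal_trans nA; rewrite cycle_subgroup_char ?cycleX.
Qed.

(** The code [inl i] stands for N_i and [inr (k, l)] for M_kl. *)
Definition class_rep (c : nat + nat * nat) : {group gT} :=
  match c with
  | inl i => <[a ^+ (p ^ i)]>
  | inr (k, l) => <[b * a ^+ (l * p ^ k.-1)]> <*> <[a ^+ (p ^ k)]>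
  end%G.

Lemma class_rep_inrE k l :
  class_rep (inr (k, l)) = <[b * a ^+ (l * p ^ k.-1)]> * <[a ^+ (p ^ k)]> :> {set gT}.
Proof.
rewrite /= norm_joinEl //.
exact: subset_trans (subsetT _) (normal_norm (cycle_p_normal k)).
Qed.

Lemma expg_ba_in k l : (0 < k)%N ->
  (b * a ^+ (l * p ^ k.-1)) ^+ p \in <[a ^+ (p ^ k)]>.
Proof.
by move=> k0; rewrite expg_ba_p -mulnA -expnSr prednK // mulnC expgM mem_cycle.
Qed.

(** The p cosets in the definition of M_kl exhaust the group because
    [expg_ba_in] reduces exponents of the generator modulo p. *)
Lemma subM_class_rep k l : (0 < k)%N -> subM p a b k l = class_rep (inr (k, l)).
Proof.
move=> k0; rewrite class_rep_inrE /subM; set g := b * _.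
have gp : g ^+ p \in <[a ^+ (p ^ k)]> by apply: expg_ba_in.
apply/setP=> x; apply/bigcupP/mulsgP => [[j _ /lcosetP[y Ny ->]]|].
  by exists (g ^+ j) y; rewrite ?mem_cycle.
case=> _ y /cycleP[j ->] Ny ->.
exists (Ordinal (ltn_pmod j p_gt0)) => //=; apply/lcosetP.
exists (g ^+ (j %/ p * p) * y).
  by rewrite groupMr // mulnC expgM groupX.
by rewrite mulgA -expgD addnC -divn_eq.
Qed.

(** The intersection with <[a]> recovers k from M_kl, also up to conjugacy as
    <[a]> is normal. *)
Lemma class_rep_inr_cap k l : (0 < k)%N ->
  class_rep (inr (k, l)) :&: <[a]> = <[a ^+ (p ^ k)]>.
Proof.
move=> k0; rewrite class_rep_inrE setIC -group_modr ?cycleX //; apply/mulGidPr.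
apply/subsetP=> x /setIP[Ax /cycleP[j def_x]].
have [/sdprodP[_ _ _ tiAB] _ _ _] := modular_facts.
have [y Ay def_g] := expg_ba (l * p ^ k.-1) j.
have : b ^+ j \in <[a]> :&: <[b]>.
  by rewrite inE mem_cycle andbT -(groupMr _ Ay) -def_g -def_x.
rewrite tiAB => /set1P/eqP; rewrite -order_dvdn; have [_ ->] := order_ab.
by case/dvdnP=> q jq; rewrite def_x jq [(q * p)%N]mulnC expgM groupX // expg_ba_in.
Qed.

Lemma class_rep_inr_ba k l : b * a ^+ (l * p ^ k.-1) \in class_rep (inr (k, l)).
Proof. by rewrite /= mem_gen // inE cycle_id. Qed.

Lemma ba_notin c : b * a ^+ c \notin <[a]>.
Proof.
rewrite groupMr ?mem_cycle //; apply/negP => Ab.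
have [/sdprodP[_ _ _ tiAB] _ _ _] := modular_facts.
have : b \in <[a]> :&: <[b]> by rewrite inE Ab cycle_id.
rewrite tiAB => /set1P b1; have [_] := order_ab; rewrite b1 order1 => p1.
by have := p_gt1; rewrite -p1.
Qed.

Lemma der1_sub_cycle k : (k < m)%N -> G^`(1) \subset <[a ^+ (p ^ k)]>.
Proof.
have [_ _ _ ->] := modular_facts => ltkm; rewrite cycle_subG.
have lek : (k <= m.-1)%N by rewrite -ltnS prednK.
by rewrite -(subnKC lek) expnD expgM mem_cycle.
Qed.

Lemma class_rep_inr_normal k l : (k < m)%N -> class_rep (inr (k, l)) <| G.
Proof.
move=> ltkm; apply: sub_der1_normal; rewrite ?subsetT //.
exact: subset_trans (der1_sub_cycle ltkm) (joing_subr _ _).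
Qed.

(** One code for each conjugacy class of proper subgroups; for k = m the M_kl
    are conjugate for all l. *)
Definition codes : seq (nat + nat * nat) :=
  [:: inl 0%N] ++ [seq inl i | i <- index_iota 1 m.+1] ++
  [seq inr (k, l) | k <- index_iota 1 m, l <- index_iota 0 p] ++
  [:: inr (m, 0%N)].

Lemma mem_inl i : (inl i \in codes) = (i <= m)%N.
Proof.
rewrite !mem_cat !mem_seq1 [inl i \in allpairs _ _ _](_ : _ = false); last first.
  by apply/allpairsP=> -[[x y] /= []].
rewrite (mem_map (f := inl)) => [|? ? [->//]]; rewrite mem_index_iota !orbF.
by case: i.
Qed.

Lemma mem_inr k l : (inr (k, l) \in codes) =
  ((0 < k < m) && (l < p) || (k == m) && (l == 0))%N.
Proof.
rewrite !mem_cat !mem_seq1 [inr _ \in map _ _](_ : _ = false) /=; last first.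
  by apply/mapP=> -[].
congr orb; apply/allpairsP/andP => [[[i j] /= [ki lj [-> ->]]]|[k0 lp]].
  by rewrite !mem_index_iota in ki lj.
by exists (k, l); rewrite !mem_index_iota.
Qed.

Lemma codes_uniq : uniq codes.
Proof.
rewrite !cat_uniq /= map_inj_uniq ?iota_uniq /=; last by move=> ? ? [].
rewrite allpairs_uniq ?iota_uniq //= ?orbF; last by move=> [? ?] [? ?] _ _ [-> ->].
apply/and4P; split=> //.
- apply/hasPn=> x; rewrite !mem_cat !mem_seq1.
  case/or3P=> [/mapP[i im ->]|/allpairsP[[u v] /= [_ _ ->]] //|/eqP-> //].
  by rewrite mem_index_iota in im; case: i im.
- apply/hasPn=> x; rewrite mem_cat mem_seq1.
  by case/orP=> [/allpairsP[[u v] /= [_ _ ->]]|/eqP->]; apply/mapP=> -[].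
apply/allpairsP=> -[[u v] /= [um _ [mu _]]].
by rewrite mem_index_iota -mu ltnn andbF in um.
Qed.

Lemma inr_codeP k l : inr (k, l) \in codes ->
  [/\ (0 < k <= m)%N, (l < p)%N & (k < m)%N \/ k = m /\ l = 0%N].
Proof.
rewrite mem_inr => /orP[/andP[/andP[k0 km] lp]|/andP[/eqP-> /eqP->]].
  by rewrite k0 ltnW //; split=> //; left.
by rewrite m_gt0 leqnn p_gt0; split=> //; right.
Qed.

Lemma class_rep_proper c : c \in codes -> class_rep c \proper G.
Proof.
have [oa ob] := order_ab; rewrite properEneq subsetT andbT.
case: c => [i _|[k l] /inr_codeP[/andP[k0 km] _ _]]; apply/eqP=> defG.
  have := in_setT (b * a ^+ 0); rewrite -defG => /(subsetP (cycleX a _)).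
  by rewrite (negPf (ba_notin 0)).
have := class_rep_inr_cap l k0; rewrite defG setTI.
move/(congr1 (fun A : {set gT} => #|A|)).
rewrite card_cycle_p // -orderE oa => /eqP; rewrite eqn_exp2l //.
by rewrite gtn_eqF // ltn_subrL k0 m_gt0.
Qed.

Lemma mulG_cycle (K : {group gT}) : ~~ (K \subset <[a]>) -> K * <[a]> = G.
Proof.
have [/sdprod_context[nA _ defG _ _] _ _ _] := modular_facts.
have [oa ob] := order_ab => nKA.
have iA : prime #|G : <[a]>|.
  by rewrite -divgS ?subsetT // card_modular -orderE oa expnS mulnK ?expn_gt0 ?p_gt0.
apply/eqP; rewrite eqEsubset subsetT -norm_joinEl /=; last first.
  exact: subset_trans (subsetT K) (normal_norm nA).
have /maxgroupP[_ maxA] := p_index_maximal (subsetT <[a]>) iA.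
apply: contraR nKA => nG; rewrite -(maxA (K <*> <[a]>)%G) ?joing_subl ?joing_subr //.
by rewrite properE subsetT.
Qed.

(** Dedekind's modular law; <[b * a ^+ c]> covers G / <[a]>. *)
Lemma subgroup_eq_cycle_mul (K : {group gT}) c : b * a ^+ c \in K ->
  K = <[b * a ^+ c]> * (K :&: <[a]>) :> {set gT}.
Proof.
move=> Kc; rewrite setIC group_modl ?cycle_subG // mulG_cycle ?setTI //.
by rewrite cycle_subG ba_notin.
Qed.

Lemma conj_b j : b ^ (a^-1 ^+ j) = b * a ^+ (j * r).
Proof.
have e : b ^ a^-1 = b * a ^+ r.
  have ab : a * b = b * a ^+ (r + 1) by rewrite -ab_rel !mulgA mulgV mul1g.
  by rewrite conjgE invgK mulgA ab addn1 expgSr mulgA mulgK.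
elim: j => [|j IHj]; first by rewrite conjg1 mulg1.
rewrite expgSr conjgM IHj conjMg e -mulgA mulSn expgD; congr (_ * (_ * _)).
by rewrite conjgE invgK mulgA -expgS expgSr mulgK.
Qed.

Lemma dvdn_exp_cycle k c : (k <= m)%N -> a ^+ c \in <[a ^+ (p ^ k)]> -> (p ^ k %| c)%N.
Proof.
have [oa _] := order_ab => lekm /cycleP[j] /eqP.
rewrite -expgM eq_expg_mod_order oa => /eqP e.
rewrite /dvdn -(modn_dvdm c (dvdn_exp2l p lekm)) e modn_dvdm ?dvdn_exp2l //.
by rewrite modnMr.
Qed.

(** For k = m the subgroup is generated by some [b * a ^+ c] of order p, that
    is with [p ^ m.-1] dividing c; conjugation by powers of a moves c through
    all such multiples, which leaves the single class of <[b]>. *)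
Lemma subgroup_code (K : {group gT}) : K :!=: G ->
  exists2 c, c \in codes & exists x, K :=: class_rep c :^ x.
Proof.
move=> ntK; have [sKA|nKA] := boolP (K \subset <[a]>).
  have [i lei defK] := cycle_subgroups sKA.
  by exists (inl i); rewrite ?mem_inl //; exists 1; rewrite conjsg1.
have KA := mulG_cycle nKA.
have [k lekm defKA] := cycle_subgroups (subsetIr K <[a]>).
have k0 : (0 < k)%N.
  rewrite lt0n; apply: contraNneq ntK => k0; rewrite k0 expn0 in defKA.
  have sAK : <[a]> \subset K by apply/setIidPr.
  by rewrite -[X in _ == X]KA (mulGidPl sAK).
have [c Kc] : exists c, b * a ^+ c \in K.
  have /mulsgP[x y Kx Ay def_b] : b \in K * <[a]> by rewrite KA inE.
  have /cycleP[c def_y] : y^-1 \in <[a]> by rewrite groupV.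
  by exists c; rewrite -def_y def_b mulgK.
have : (p ^ k.-1 %| c)%N.
  have : a ^+ (c * p) \in K :&: <[a]>.
    by rewrite inE mem_cycle andbT -expg_ba_p groupX.
  rewrite /= defKA => /(dvdn_exp_cycle lekm).
  by rewrite -{1}(prednK k0) expnSr dvdn_pmul2r.
case/dvdnP=> d def_c; have [ltkm|] := ltnP k m.
  exists (inr (k, (d %% p)%N)); first by rewrite mem_inr k0 ltkm ltn_pmod.
  exists 1; rewrite conjsg1 class_rep_inrE -defKA; apply: subgroup_eq_cycle_mul.
  have : b * a ^+ (d %% p * p ^ k.-1) * a ^+ (p ^ k * (d %/ p)) \in K.
    have -> : (p ^ k = p * p ^ k.-1)%N by rewrite -expnS prednK.
    rewrite -mulgA -expgD.
    suff <- : c = (d %% p * p ^ k.-1 + p * p ^ k.-1 * (d %/ p))%N by [].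
    by rewrite def_c {1}(divn_eq d p); ring.
  rewrite groupMr // expgM groupX //.
  by have := cycle_id (a ^+ (p ^ k)); rewrite -defKA => /setIP[].
move=> lemk; have km : k = m by apply/eqP; rewrite eqn_leq lekm.
rewrite {k lekm lemk k0}km in defKA def_c.
exists (inr (m, 0%N)); first by rewrite mem_inr !eqxx orbT.
exists (a^-1 ^+ d).
rewrite (subgroup_eq_cycle_mul Kc) /= defKA a_pow cycle1 joingG1 mulg1.
by rewrite -cycleJ mul0n expg0 mulg1 conj_b -def_c.
Qed.

Lemma class_rep_nonconj c d x : c \in codes -> d \in codes ->
  class_rep c :=: class_rep d :^ x -> c = d.
Proof.
have [/sdprod_context[nA _ _ _ _] _ _ _] := modular_facts.
have normJ (N : {group gT}) : N <| G -> N :^ x = N.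
  by move=> nN; apply: (normsP (normal_norm nN)); rewrite inE.
have inlA i : class_rep (inl i) \subset <[a]> by apply: cycleX.
have inrA k l : ~~ (class_rep (inr (k, l)) \subset <[a]>).
  by apply/negP => /subsetP/(_ _ (class_rep_inr_ba k l)); apply/negP/ba_notin.
have Ninj i j : (i <= m)%N -> (j <= m)%N ->
    <[a ^+ (p ^ i)]> = <[a ^+ (p ^ j)]> -> i = j.
  move=> im jm /(congr1 (fun A : {set gT} => #|A|)); rewrite !card_cycle_p //.
  by move/eqP; rewrite eqn_exp2l // => /eqP e; rewrite -(subKn im) e subKn.
case: c d => [i|[k l]] [j|[k' l']] cC dC def_c.
- congr inl; apply: Ninj; rewrite -?mem_inl //.
  by rewrite -(normJ _ (cycle_p_normal j)).
- case/negP: (inrA k' l'); rewrite -(conjSg _ _ x) -def_c normJ //; exact: inlA.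
- by case/negP: (inrA k l); rewrite def_c -(normJ _ nA) conjSg inlA.
have [/andP[k0 km] lp casek] := inr_codeP cC.
have [/andP[k'0 k'm] lp' casek'] := inr_codeP dC.
have e : k = k'.
  apply: Ninj => //; rewrite -(class_rep_inr_cap l k0).
  rewrite -(class_rep_inr_cap l' k'0) def_c.
  by rewrite -{1}(normJ _ nA) -conjIg class_rep_inr_cap // normJ // cycle_p_normal.
subst k'.
case: casek casek' => [ltkm _|[-> ->] [|[_ ->//]]]; last by rewrite ltnn.
rewrite (normJ _ (class_rep_inr_normal l' ltkm)) in def_c.
have inj_l u v : (u <= v < p)%N -> b * a ^+ (u * p ^ k.-1) \in class_rep (inr (k, l)) ->
    b * a ^+ (v * p ^ k.-1) \in class_rep (inr (k, l)) -> u = v.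
  case/andP=> leuv ltvp Mu Mv.
  have Ma : a ^+ ((v - u) * p ^ k.-1) \in class_rep (inr (k, l)).
    have := groupM (groupVr Mu) Mv.
    by rewrite invMg -mulgA mulKg -{1}(subnKC leuv) mulnDl expgD mulKg.
  have : a ^+ ((v - u) * p ^ k.-1) \in class_rep (inr (k, l)) :&: <[a]>.
    by rewrite inE Ma mem_cycle.
  rewrite class_rep_inr_cap // => /(dvdn_exp_cycle km).
  rewrite -{1}(prednK k0) expnS dvdn_pmul2r ?expn_gt0 ?p_gt0 // => dvp.
  apply/eqP; rewrite eqn_leq leuv -subn_eq0 /=; apply: contraTT dvp => nz.
  by rewrite gtnNdvd ?lt0n // (leq_ltn_trans (leq_subr _ _)).
have Ml := class_rep_inr_ba k l; have Ml' := class_rep_inr_ba k l'.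
rewrite -def_c in Ml'.
case/orP: (leq_total l l') => le; congr (inr (_, _)).
  by apply: inj_l => //; rewrite le.
by apply/esym/inj_l => //; rewrite le.
Qed.

(** * Products of generators *)

Local Open Scope ring_scope.

Definition gen c : burnside gT := coset_class (class_rep c).

(** The smaller weight goes to the N_i with i > 0, which are the subgroups of
    Phi(G). *)
Definition weight (n : nat) (c : nat + nat * nat) : nat :=
  match c with inl i.+1 => p ^ n.-1 | _ => p ^ n end.

Definition code_span n : burnside gT -> Prop :=
  inIntSpan (in_tuple [seq gen c *+ weight n c | c <- codes]).

Lemma mem_span n c j : c \in codes -> (weight n c %| j)%N -> code_span n (gen c *+ j).
Proof.
move=> cC /dvdnP[q ->]; rewrite mulnC mulrnA; apply: zmod_predMn.
  exact: int_span_zmod.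
by apply: mem_int_span; apply: (map_f (fun c => gen c *+ weight n c)).
Qed.

Lemma mem_span_Phi n (K : {group gT}) j : (K \subset <[a ^+ p]>)%g ->
  (p ^ n.-1 %| j)%N -> code_span n (coset_class K *+ j).
Proof.
move=> sKPhi.
have [[|i] lei defK] := cycle_subgroups (subset_trans sKPhi (cycleX a p)).
  have := subset_leq_card sKPhi; rewrite defK -{2}[p]expn1 !card_cycle_p //.
  by rewrite leq_exp2l // subn0 leqNgt ltn_subrL m_gt0.
move=> dvj; have -> : coset_class K = gen (inl i.+1) by rewrite /coset_class defK.
by apply: mem_span => //; rewrite mem_inl.
Qed.

Lemma mem_span_proper n (K : {group gT}) j : K \proper [set: gT] ->
  (p ^ n %| j)%N -> code_span n (coset_class K *+ j).
Proof.
rewrite properEneq => /andP[ntK _] dvj.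
have [c cC [x defK]] := subgroup_code ntK.
have -> : coset_class K = gen c.
  by rewrite /coset_class defK -/(coset_class _) coset_class_conj.
apply: mem_span => //; apply: dvdn_trans dvj.
by case: c {cC defK} => [[|i]|?] //=; rewrite dvdn_exp2l ?leq_pred.
Qed.

Lemma index_Phi : #|[set: gT] : 'Phi([set: gT])|%g = (p ^ 2)%N.
Proof.
have [_ -> _ _] := modular_facts.
have := card_cycle_p m_gt0; rewrite expn1 => oPhi.
rewrite -divgS ?subsetT // card_modular oPhi -expnB ?(leqW (leq_subr _ _)) //.
by rewrite subnBA // addn1 -addn2 addKn.
Qed.

(** Either KL = G, so K :&: L lies in Phi(G), or p divides |G : KL|. *)
Lemma span_coset_classM (K L : {group gT}) :
    (K <| [set: gT])%g -> K \proper [set: gT] -> L \proper [set: gT] ->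
  code_span 1 (coset_class K * coset_class L).
Proof.
move=> nK pK pL; rewrite coset_classM //.
have [KL|KL] := eqVneq (K <*> L)%g [set: gT].
  apply: mem_span_Phi => //; have [_ <- _ _] := modular_facts.
  exact (cap_sub_Phi modular_pgroup index_Phi pK pL KL).
apply: mem_span_proper; first exact: sub_proper_trans (subsetIl _ _) pK.
by apply: (p_dvd_index modular_pgroup); rewrite properEneq KL subsetT.
Qed.

(** [G/B]^2, for B = <[b]> of order p, is c [G/B] + d [G/1] since stabilisers lie
    in conjugates of B. The mark at B kills [G/1] and is nonzero on [G/B], so c
    is the mark |N(B) : B|. *)
Lemma span_betaM : code_span 1 (gen (inr (m, 0%N)) * gen (inr (m, 0%N))).
Proof.
have inM : inr (m, 0%N) \in codes by rewrite mem_inr !eqxx orbT.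
pose M := class_rep (inr (m, 0%N)); rewrite /gen -/M; set u := coset_class M.
have pM : M \proper [set: gT] by apply: class_rep_proper.
have oM : #|M| = p.
  rewrite /M /= a_pow cycle1 joingG1 mul0n expg0 mulg1 -orderE.
  by have [] := order_ab.
have [X defX] := burnside_class_orbits (prod_act (coset_act M) (coset_act M)).
have stab Y : exists x,
    'C[Y | prod_act (coset_act M) (coset_act M)]%g \subset (M :^ x)%g.
  have /lcosetsP[x _ hx] := valP Y.1; exists x^-1%g.
  rewrite -(@astab1_coset _ _ Y.1) ?hx ?lcoset_refl //.
  apply/subsetP=> g /astab1P e; apply/astab1P; exact (congr1 fst e).
have [c [d def_uu]] : exists c d, u * u = u *+ c + coset_class 1%g *+ d.
  rewrite -burnside_classM defX; elim: X {defX} => [|Y X [c [d IHX]]].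
    by exists 0%N, 0%N; rewrite big_nil addr0.
  rewrite big_cons IHX; have [x sx] := stab Y.
  have := cardSg sx; rewrite cardJg oM => dvp.
  have [o1|op] : #|'C[Y | prod_act (coset_act M) (coset_act M)]%g| = 1%N \/
       #|'C[Y | prod_act (coset_act M) (coset_act M)]%g| = p.
    by apply/pred2P; have /primeP[_] := p_prime; apply.
    exists c, d.+1; rewrite mulrS [in RHS]addrCA; congr (coset_class _ + _).
    by apply/eqP; rewrite trivg_card1 /= o1.
  exists c.+1, d; rewrite mulrS -addrA; congr (_ + _).
  transitivity (coset_class (M :^ x)%g); last exact: coset_class_conj.
  congr coset_class; apply/eqP.
  by rewrite eqEcard sx cardJg oM op /=.
have := congr1 (mark M) def_uu.
rewrite rmorphM rmorphD !rmorphMn mark_coset_class_self.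
have -> : mark M (coset_class 1%g) = 0.
  apply/eqP/idPn => /mark_coset_class_sub[x]; rewrite conjs1g => /subset_leq_card.
  by rewrite oM cards1 leqNgt p_gt1.
rewrite mul0rn addr0 -mulr_natr natz -!PoszM => -[] /eqP.
rewrite eqn_pmul2l // => /eqP def_c.
rewrite def_uu; apply: zmod_predD; first exact: int_span_zmod.
  apply: mem_span_proper => //; rewrite expn1 -def_c.
  apply: (p_dvd_index modular_pgroup).
  have := nilpotent_proper_norm (pgroup_nil modular_pgroup) pM.
  by rewrite setTI.
by apply: mem_span_Phi; rewrite ?sub1G ?dvd1n.
Qed.

Lemma span_genM c d : c \in codes -> d \in codes -> code_span 1 (gen c * gen d).
Proof.
move=> cC dC.
have nsub e : e \in codes -> e != inr (m, 0%N) -> (class_rep e <| [set: gT])%g.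
  case: e => [i _ _|[k l] /inr_codeP[_ _ [ltkm|[-> ->]]]]; last by rewrite eqxx.
    exact: cycle_p_normal.
  by move=> _; apply: class_rep_inr_normal.
have [cm|/(nsub _ cC) nc] := eqVneq c (inr (m, 0%N)); last first.
  by apply: span_coset_classM => //; apply: class_rep_proper.
have [dm|/(nsub _ dC) nd] := eqVneq d (inr (m, 0%N)); last first.
  by rewrite mulrC; apply: span_coset_classM => //; apply: class_rep_proper.
by rewrite cm dm; apply: span_betaM.
Qed.

(** Phi(G) consists of nongenerators, so a proper subgroup times a subgroup of
    Phi(G) is proper and p divides its index. *)
Lemma span_gen_PhiM n c i : c \in codes -> (i.+1 <= m)%N ->
  code_span n.+1 (gen c * (gen (inl i.+1) *+ p ^ n.-1)).
Proof.
move=> cC lei; rewrite mulrnAr mulrC coset_classM ?cycle_p_normal // -mulrnA.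
have sNPhi : (<[a ^+ (p ^ i.+1)]> \subset <[a ^+ p]>)%g.
  by rewrite cycle_subG expnS expgM mem_cycle.
apply: mem_span_Phi; first exact: subset_trans (subsetIl _ _) sNPhi.
rewrite (@dvdn_trans (p * p ^ n.-1)) //=.
  by case: n => [|n] //=; rewrite -expnS.
rewrite dvdn_mul // (p_dvd_index modular_pgroup) // properEneq subsetT andbT.
apply/eqP=> defG; have := class_rep_proper cC; rewrite properE subsetT /= => /negP[].
rewrite -(genGid (class_rep c)) (@Phi_nongen _ [set: gT]) //.
apply/eqP; rewrite eqEsubset subsetT -{1}defG genS //.
by have [_ -> _ _] := modular_facts; apply: setSU.
Qed.

Lemma gen_augmentation c : c \in codes -> augmentation_ideal (gen c).
Proof. by move=> cC; apply: augmentation_coset_class; apply: class_rep_proper. Qed.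

Lemma span0_augmentation x : code_span 0 x -> augmentation_ideal x.
Proof.
apply: int_span_ind; first exact: augmentation_ideal_zmod.
move=> _ /mapP[c cC ->]; apply: zmod_predMn; first exact: augmentation_ideal_zmod.
exact: gen_augmentation.
Qed.

(** Modulo the span of the proper coset classes, every class is an integer,
    and the augmentation of the class is that integer. *)
Lemma augmentation_span0 x : augmentation_ideal x -> code_span 0 x.
Proof.
have spanZ := int_span_zmod [seq gen c *+ weight 0 c | c <- codes].
have class_span (T : finType) (to : {action gT &-> T}) :
    exists k : nat, code_span 0 (burnside_class to - k%:R).
  have [X ->] := burnside_class_orbits to; elim: X => [|t X [k IHX]].
    by exists 0%N; rewrite big_nil subr0; apply: spanZ.1.
  have [defG|ntC] := eqVneq 'C[t | to]%g [set: gT].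
    by exists k.+1; rewrite big_cons defG coset_classT mulrS opprD addrACA subrr add0r.
  exists k; rewrite big_cons -addrA; apply: zmod_predD => //.
  rewrite -[coset_class _]mulr1n; apply: (@mem_span_proper 0 'C[t | to]%G) => //.
  by rewrite properEneq ntC subsetT.
have [y [z ->]] := completion_inB x.
have ein w : completion_in w = burnside_class (class_act w) :> burnside gT.
  by rewrite /burnside_class class_actK.
rewrite !ein.
have [j Sj] := class_span _ (class_act y).
have [k Sk] := class_span _ (class_act z).
set u := burnside_class _ in Sj *; set v := burnside_class _ in Sk *.
move=> Dx; have Sx : code_span 0 (u - v - (j%:R - k%:R)).
  have -> : u - v - (j%:R - k%:R) = (u - j%:R) - (v - k%:R) by ring.
  exact: spanZ.2.
have /eqP := span0_augmentation Sx.
rewrite rmorphB Dx sub0r oppr_eq0 rmorphB !rmorph_nat subr_eq0 !natz eqz_nat.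
by move/eqP=> jk; rewrite jk subrr subr0 in Sx.
Qed.

Lemma span_mulpX n x : code_span 1 x -> code_span n.+1 (x *+ p ^ n).
Proof.
move: x; apply: int_span_ind => [|_ /mapP[c cC ->]].
  split=> [|x y Sx Sy]; first by rewrite mul0rn; apply: (int_span_zmod _).1.
  by rewrite mulrnBl; apply: (int_span_zmod _).2.
rewrite -mulrnA; apply: mem_span => //.
by case: c {cC} => [[|i]|?] /=; rewrite ?mul1n // -?expnD ?addn1 ?add1n.
Qed.

(** The induction starts at n = 0, where all weights are 1 and the span is
    Delta itself. In the step, generators of weight p^(n+1) are reached by a
    maximal overgroup, and alpha_i with i > 0 as alpha_0 beta_i0. *)
Lemma ideal_exp_span n x :
  ideal_exp (@augmentation_ideal gT) n.+1 x <-> code_span n x.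
Proof.
have Dz := augmentation_ideal_zmod gT.
have spanZ k := int_span_zmod [seq gen c *+ weight k c | c <- codes].
elim: n x => [|n IHn] x.
  split=> [|Sx]; last first.
    rewrite -[x]mulr1; apply: ideal_expSM => //; exact: span0_augmentation.
  move: x; apply: (ideal_expS_ind (spanZ 0)) => x y Dx _.
  by apply: augmentation_span0; rewrite /augmentation_ideal rmorphM Dx mul0r.
split; move: x.
  apply: (ideal_expS_ind (spanZ n.+1)) => x y /augmentation_span0 Sx /IHn Sy.
  move: x Sx; apply: int_span_ind => [|_ /mapP[c cC ->]].
    split=> [|x z Sx Sz]; first by rewrite mul0r; apply: (spanZ _).1.
    by rewrite mulrBl; apply: (spanZ _).2.
  rewrite mulrnAl; apply: zmod_predMn; first exact: spanZ.
  move: y Sy; apply: int_span_ind => [|_ /mapP[d dC ->]].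
    split=> [|x z Sx Sz]; first by rewrite mulr0; apply: (spanZ _).1.
    by rewrite mulrBr; apply: (spanZ _).2.
  case: d dC => [[|i]|kl] dC /=.
  - by rewrite mulrnAr; apply/span_mulpX/span_genM.
  - by apply: span_gen_PhiM; rewrite -?mem_inl.
  - by rewrite mulrnAr; apply/span_mulpX/span_genM.
apply: int_span_ind; first exact: ideal_exp_zmod.
move=> _ /mapP[c cC ->].
have genX d : d \in codes -> weight n d = (p ^ n)%N ->
    ideal_exp (@augmentation_ideal gT) n.+1 (gen d *+ p ^ n).
  by move=> dC <-; apply/IHn/mem_span.
have pgen : weight n c = (p ^ n)%N -> 
    ideal_exp (@augmentation_ideal gT) n.+2 (gen c *+ p ^ n.+1).
  move=> wc; have [defG|[T maxT scT]] := maximal_exists (subsetT (class_rep c)).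
    by have := class_rep_proper cC; rewrite defG properxx.
  have iT := p_maximal_index modular_pgroup maxT.
  have -> : gen c *+ p ^ n.+1 = coset_class T * (gen c *+ p ^ n).
    rewrite mulrnAr coset_classM ?(p_maximal_normal modular_pgroup maxT) //.
    by rewrite (setIidPr scT) (joing_idPl scT) iT -mulrnA -expnS.
  apply: ideal_expSM; last exact: genX.
  by apply: augmentation_coset_class; apply: maxgroupp maxT.
case: c cC pgen => [[|i]|kl] cC pgen; [exact: pgen| |exact: pgen].
rewrite mem_inl in cC.
have dC : inr (i.+1, 0%N) \in codes.
  by rewrite mem_inr p_gt0 eqxx !andbT /= orbC -leq_eqVlt.
have -> : gen (inl i.+1) *+ weight n.+1 (inl i.+1) =
    gen (inl 0%N) * (gen (inr (i.+1, 0%N)) *+ p ^ n).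
  rewrite mulrnAr coset_classM ?cycle_p_normal //.
  have -> : class_rep (inl 0%N) = <[a]>%G by apply: val_inj.
  have [/sdprod_context[nA _ _ _ _] _ _ _] := modular_facts.
  rewrite joingC norm_joinEl; last first.
    exact: subset_trans (subsetT _) (normal_norm nA).
  rewrite mulG_cycle ?indexgg ?mulr1n; last first.
    by apply/negP=> /subsetP/(_ _ (class_rep_inr_ba i.+1 0)); apply/negP/ba_notin.
  by congr (coset_class _ *+ _); rewrite setIC; apply/esym/class_rep_inr_cap.
apply: ideal_expSM; last exact: genX.
by apply: gen_augmentation; rewrite mem_inl.
Qed.

Lemma span_basis n :
  int_basis (ideal_exp (@augmentation_ideal gT) n.+1)
    [seq gen c *+ weight n c | c <- codes].
Proof.
split=> [x|]; first exact: ideal_exp_span.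
set s := [seq _ | _ <- _] => c sum0 i0.
pose w (i : 'I_(size s)) := weight n (nth (inl 0%N) codes i).
have lt_code (i : 'I_(size s)) : (i < size codes)%N.
  by rewrite -(size_map (fun c => gen c *+ weight n c)).
have w0 : (w i0 != 0)%N.
  by rewrite -lt0n /w; case: (nth _ _ _) => [[|k]|?]; rewrite /= expn_gt0 p_gt0.
suffices /eqP: c i0 *+ w i0 = 0 by rewrite Num.Theory.mulrn_eq0 (negPf w0) => /eqP.
have free := @coset_class_free gT 'I_(size s)
  (fun i => class_rep (nth (inl 0%N) codes i)) (fun i => c i *+ w i).
refine (free _ _ i0) => [i j x e|].
  apply/ord_inj/eqP; rewrite -(nth_uniq (inl 0%N) _ _ codes_uniq) //.
  by apply/eqP/(class_rep_nonconj _ _ e); apply: mem_nth.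
rewrite -[RHS]sum0; apply: eq_bigr => i _.
by rewrite (nth_map (inl 0%N)) // -mulr_natl natz mulrzA -pmulrn.
Qed.

End ModularGroup.

Theorem theorem4p1 (p m n : nat) (gT : finGroupType) (a b : gT)
    (p_prime : prime p) (p_odd : odd p) (m_ge3 : (3 <= m)%N) (n_gt0 : (0 < n)%N)
    (H_presented :
       ([set: gT] \isog Grp (x : y : x ^+ (p ^ m)%N, y ^+ p,
                                     x ^ y = x ^+ (p ^ m.-1 + 1)%N))%g)
    (ab_gen : (<<[set a; b]>> = [set: gT])%g)
    (a_pow : (a ^+ (p ^ m)%N = 1)%g)
    (b_pow : (b ^+ p = 1)%g)
    (ab_rel : (b^-1 * a * b = a ^+ (p ^ m.-1 + 1)%N)%g) :
  int_basis (ideal_exp (@augmentation_ideal gT) n.+1)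
    ([:: alpha p a 0 *+ p ^ n]
     ++ [seq alpha p a i *+ p ^ n.-1 | i <- index_iota 1 m.+1]
     ++ [seq beta p a b k l *+ p ^ n | k <- index_iota 1 m, l <- index_iota 0 p]
     ++ [:: beta p a b m 0 *+ p ^ n]).
Proof.
have betaE k l : (0 < k)%N -> beta p a b k l = gen p a b (inr (k, l)).
  move=> k0; rewrite /beta -/(coset_class (subM p a b k l)).
  by rewrite (subM_class_rep p_prime p_odd m_ge3 H_presented).
have := span_basis p_prime p_odd m_ge3 H_presented ab_gen a_pow b_pow ab_rel n.
rewrite /codes !map_cat -map_comp map_allpairs /= -betaE ?(leq_trans _ m_ge3) //.
congr (int_basis _ (_ :: (_ ++ _ ++ _))).
  apply/eq_in_map=> -[|i] //; by rewrite mem_index_iota.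
by apply/eq_in_allpairs => k l; rewrite mem_index_iota => /andP[k0 _] _; rewrite -betaE.
Qed.
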